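(* Suppose $\Sigma_0\neq\Sigma$ and $\beta_0=\beta$, and assume isotropic signals, $\mathbb E[\beta\beta^\top]=(\alpha^2/p)I$. Let $\mathrm{SNR}=\alpha^2/\sigma^2$. Then $$\lambda^*(\phi)=\frac{\phi}{\mathrm{SNR}}=\arg\min_\lambda\mathbb E_\beta[\mathscr R(\lambda,\phi)].$$ Furthermore, for $\lambda_{\min}<0$ such that $X^\top X/n\succ-\lambda_{\min}I$, even the non-asymptotic out-of-distribution risk $R(\hat\beta^\lambda)=\mathbb E_{x_0,y_0}[(x_0^\top\hat\beta^\lambda-y_0)^2\mid X,y]$ is minimized (over $\lambda\ge\lambda_{\min}$) at $\lambda_p^*=\phi_p/\mathrm{SNR}$, where $\phi_p=p/n$.
   Context: Data: the train samples $(x_i,y_i)$, $i=1,\dots,n$, are i.i.d. copies of $(x,y)\in\mathbb R^p\times\mathbb R$. Here $x=\Sigma^{1/2}z$, where $z$ has i.i.d. entries of mean $0$, variance $1$ and uniformly bounded moment of order $4+\delta$ for some $\delta>0$; $\Sigma\in\mathbb R^{p\times p}$ is deterministic and symmetric with eigenvalues uniformly bounded away from $0$ and $+\infty$. The response $y$ has mean $0$ and uniformly bounded moment of order $4+\nu$ for some $\nu>0$. The vector $\beta=\mathbb E[xx^\top]^{-1}\mathbb E[xy]$ is the $L_2$ linear projection parameter of $y$ on $x$, so $y=x^\top\beta+\varepsilon$ with $\varepsilon$ uncorrelated with $x$ and $\mathbb E[\varepsilon^2]=\sigma^2$ ($\sigma^2$ is the variance of the conditional distribution of $y$ given $x$);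 no linear model is assumed. The test point $(x_0,y_0)$ is independent of the train data and satisfies the same assumptions with parameters $(\Sigma_0,\beta_0,\sigma_0^2)$ in place of $(\Sigma,\beta,\sigma^2)$. In the result the signal $\beta=\beta_0$ is random, $\mathbb E_\beta$ is expectation over it, and $\alpha^2$ is the signal energy. $X\in\mathbb R^{n\times p}$ is the train feature matrix with rows $x_i^\top$, $y\in\mathbb R^n$ also denotes the train response vector, and $\hat\beta^\lambda=(X^\top X/n+\lambda I_p)^\dagger X^\top y/n$ is the ridge estimator ($\dagger$ = Moore-Penrose pseudoinverse). The asymptotic regime is $n,p\to\infty$ with $p/n\to\phi\in(0,\infty)$. Deterministic equivalent: write $\overline{\mathrm{tr}}[A]=\mathrm{tr}[A]/p$ for $A\in\mathbb R^{p\times p}$, and let $r_{\min}$ be the smallest eigenvalue of $\Sigma$. Let $\mu_{\min}>-r_{\min}$ be the unique solution of $1=\phi\,\overline{\mathrm{tr}}[\Sigma^2(\Sigma+\mu_{\min}I)^{-2}]$ and $\lambda_{\min}(\phi)=\mu_{\min}-\phi\,\overline{\mathrm{tr}}[\mu_{\min}\Sigma(\Sigma+\mu_{\min}I)^{-1}]$. For $\lambda>\lambda_{\min}(\phi)$, let $\mu=\mu(\lambda,\phi)$ be the solution with $\mu>\mu_{\min}$ of $\mu=\lambda+\phi\,\overline{\mathrm{tr}}[\mu\Sigma(\Sigma+\mu I)^{-1}]$, and $$\tilde v=\frac{\phi\,\overline{\mathrm{tr}}[\Sigma_0\Sigma(\Sigma+\mu I)^{-2}]}{1-\phi\,\overline{\mathrm{tr}}[\Sigma^2(\Sigma+\mu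 I)^{-2}]}.$$ The deterministic equivalent of $R(\hat\beta^\lambda)$ is $\mathscr R(\lambda,\phi)=\mathscr B+\mathscr V+\mathscr S+\kappa^2$, where $\mathscr B=\mu^2\beta^\top(\Sigma+\mu I)^{-1}(\tilde v\Sigma+\Sigma_0)(\Sigma+\mu I)^{-1}\beta$, $\mathscr V=\sigma^2\tilde v$, $\mathscr S=2\mu\,\beta^\top(\Sigma+\mu I)^{-1}\Sigma_0(\beta_0-\beta)$ and $\kappa^2=(\beta_0-\beta)^\top\Sigma_0(\beta_0-\beta)+\sigma_0^2$. The optimal penalty $\lambda^*(\phi)$ is the minimizer, over $\lambda\ge\lambda_{\min}(\phi)$ in the extended reals, of the (here $\beta$-averaged) equivalent.
   Formalization: The finite-sample claim is proved for the risk averaged over the signal β and over the response noise given X, not for fixed (X,y), where it is false; E[ε²]=σ² and Var(y|x)=σ² are both assumed, which forces E[y|x]=xᵀβ. *)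

(* Defs.v *)
From HB Require Import structures.
From mathcomp Require Import all_boot all_order all_algebra.
From mathcomp Require Import all_classical all_reals all_analysis.
From mathcomp Require Import measurable_realfun.

Set Implicit Arguments.
Unset Strict Implicit.
Unset Printing Implicit Defensive.

Import Order.TTheory GRing.Theory Num.Theory.
Import numFieldNormedType.Exports.

Local Open Scope classical_set_scope.
Local Open Scope ring_scope.

Section Matrices.
Variables (R : realType) (p : nat).

Definition psdmx (A : 'M[R]_p) : Prop :=
  A^T = A /\ forall u : 'cV[R]_p, 0 <= (u^T *m A *m u) 0 0.

Definition posdefmx (A : 'M[R]_p) : Prop :=
  A^T = A /\ forall u : 'cV[R]_p, u != 0 -> 0 < (u^T *m A *m u) 0 0.

Definition sqrtmx (A : 'M[R]_p) : 'M[R]_p :=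
  xget 0 [set B : 'M[R]_p | psdmx B /\ B *m B = A].

(* The library's [pinvmx] is only a partial inverse, so the Moore-Penrose
   inverse is taken to be the unique solution of the four Penrose equations. *)
Definition mpinv (A : 'M[R]_p) : 'M[R]_p :=
  xget 0 [set B : 'M[R]_p | [/\ A *m B *m A = A, B *m A *m B = B,
                              (A *m B)^T = A *m B & (B *m A)^T = B *m A]].

Definition ntr (A : 'M[R]_p) : R := \tr A / p%:R.

Definition qform (u : 'cV[R]_p) (A : 'M[R]_p) (v : 'cV[R]_p) : R :=
  (u^T *m A *m v) 0 0.

Definition tuple_of_col (v : 'cV[R]_p) : p.-tuple R := [tuple v j 0 | j < p].

End Matrices.

Section Estimator.
Variables (R : realType) (n p : nat).

Definition gram (X : 'M[R]_(n, p)) : 'M[R]_p := n%:R^-1 *: (X^T *m X).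

Definition ridge (X : 'M[R]_(n, p)) (Y : 'cV[R]_n) (lambda : R) : 'cV[R]_p :=
  mpinv (gram X + lambda%:M) *m (n%:R^-1 *: (X^T *m Y)).

End Estimator.

Definition SNR (R : realType) (alpha sigma : R) : R := alpha ^+ 2 / sigma ^+ 2.

(* For Sigma positive definite, phi > 0 and lambda > lambda_min, each equation
   below has exactly one solution in the indicated range, so [xget 0] returns
   "the" solution. *)
Section DeterministicEquivalent.
Variables (R : realType) (p : nat) (Sigma Sigma0 : 'M[R]_p) (phi : R).

Definition resolvent (mu : R) : 'M[R]_p := invmx (Sigma + mu%:M).

Definition eigen_min : R := inf [set a : R | eigenvalue Sigma a].

Definition mu_min : R :=
  xget 0 [set mu : R | - eigen_min < mu /\
    1 = phi * ntr (Sigma *m Sigma *m resolvent mu *m resolvent mu)].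

Definition lambda_min : R :=
  mu_min - phi * ntr (mu_min *: (Sigma *m resolvent mu_min)).

Definition mu_of (lambda : R) : R :=
  xget 0 [set mu : R | mu_min < mu /\
    mu = lambda + phi * ntr (mu *: (Sigma *m resolvent mu))].

Definition vtilde (lambda : R) : R :=
  let G := resolvent (mu_of lambda) in
  phi * ntr (Sigma0 *m Sigma *m G *m G) /
  (1 - phi * ntr (Sigma *m Sigma *m G *m G)).

Variables (sigma sigma0 : R) (beta beta0 : 'cV[R]_p).

Definition equiv_bias (lambda : R) : R :=
  let mu := mu_of lambda in let G := resolvent mu in
  mu ^+ 2 * qform beta (G *m (vtilde lambda *: Sigma + Sigma0) *m G) beta.

Definition equiv_var (lambda : R) : R := sigma ^+ 2 * vtilde lambda.

Definition equiv_shift (lambda : R) : R :=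
  let mu := mu_of lambda in
  2 * mu * qform beta (resolvent mu *m Sigma0) (beta0 - beta).

Definition equiv_kappa2 : R :=
  qform (beta0 - beta) Sigma0 (beta0 - beta) + sigma0 ^+ 2.

Definition equiv_risk (lambda : R) : R :=
  equiv_bias lambda + equiv_var lambda + equiv_shift lambda + equiv_kappa2.

End DeterministicEquivalent.

Section Minimization.
Variable R : realType.

Definition argmin_on (U : Type) (D : set U) (f : U -> \bar R) : set U :=
  [set u | D u /\ forall v, D v -> (f u <= f v)%E].

(* [f] is given by its formula on ]lmin, +oo[ only; at the endpoints of the
   extended half-line [lmin, +oo] it takes its limits there.  The values below
   lmin are never used. *)
Definition extend_to_endpoints (lmin : R) (f : R -> \bar R) (l : \bar R)
    : \bar R :=
  match l with
  | r%:E => if r == lmin then lim (f r @[r --> lmin^'+]) else f r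
  | +oo%E => lim (f r @[r --> +oo%R])
  | -oo%E => +oo%E
  end.

End Minimization.

Section Probability.
Variables (R : realType) (d : measure_display) (T : measurableType d).
Variable P : probability T R.

(* Taking some of the [B i] to be [setT] yields the product rule for every
   subfamily. *)
Definition mutually_independent (d' : measure_display) (U : measurableType d')
    (I : finType) (X : I -> T -> U) : Prop :=
  forall B : I -> set U, (forall i, measurable (B i)) ->
  P (\bigcap_(i in [set: I]) (X i @^-1` B i)) =
  (\prod_(i : I) P (X i @^-1` B i))%E.

Definition identically_distributed (d' : measure_display)
    (U : measurableType d') (I : Type) (X : I -> T -> U) : Prop :=
  forall (i j : I) (B : set U), measurable B ->
  P (X i @^-1` B) = P (X j @^-1` B).

(* [h u] is a version of E[f | X = u], i.e. [h \o X] is one of E[f | X]. *)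
Definition cond_expectation (d' : measure_display) (U : measurableType d')
    (X : T -> U) (f : T -> \bar R) (h : U -> \bar R) : Prop :=
  measurable_fun [set: U] h /\
  forall B : set U, measurable B ->
    (\int[P]_(w in X @^-1` B) f w = \int[P]_(w in X @^-1` B) h (X w))%E.

End Probability.

Section Model.
Variables (R : realType) (d : measure_display) (T : measurableType d).
Variables (P : probability T R) (p : nat).

Definition feature (Sigma : 'M[R]_p) (z : 'I_p -> {RV P >-> R}) (w : T)
    : 'cV[R]_p :=
  sqrtmx Sigma *m (\col_j z j w).

(* One observation (x, y) with x = Sigma^{1/2} z.  Since the signal is itself
   random in the application, the response comes as a family: [y b] is the
   response when the signal equals [b], and the law of [y b] given x may depend
   on [b].  No linear model is imposed: [b] is only the L2 projection parameter
   of [y b] on x.  Moment and eigenvalue bounds that are uniform along a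
   sequence of sizes become finiteness and positivity at a given size. *)
Record population (Sigma : 'M[R]_p) (sigma : R) (z : 'I_p -> {RV P >-> R})
    (y : 'cV[R]_p -> {RV P >-> R}) : Prop := Population {
  pop_sym : Sigma^T = Sigma;
  pop_eigen : forall a : R, eigenvalue Sigma a -> 0 < a;
  pop_z_indep : mutually_independent P (fun j => z j : T -> R);
  pop_z_id : identically_distributed P (fun j => z j : T -> R);
  pop_z_mean : forall j, 'E_P[z j]%E = 0%E;
  pop_z_var : forall j, 'V_P[z j]%E = 1%E;
  pop_z_moment : exists2 delta : R, 0 < delta &
    forall j, ('E_P[(fun w => `|z j w| `^ (4 + delta))%R] < +oo)%E;
  pop_y_mean : forall b, 'E_P[y b]%E = 0%E;
  pop_y_moment : exists2 nu : R, 0 < nu &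
    forall b, ('E_P[(fun w => `|y b w| `^ (4 + nu))%R] < +oo)%E;
  pop_projection : forall b,
    let x := feature Sigma z in
    b = invmx (\matrix_(j, k) fine 'E_P[(fun w => x w j 0 * x w k 0)%R]%E) *m
        (\col_j fine 'E_P[(fun w => x w j 0 * y b w)%R]%E);
  pop_noise_var : forall b,
    'E_P[(fun w => (y b w - ((feature Sigma z w)^T *m b) 0 0) ^+ 2)%R]%E =
    (sigma ^+ 2)%:E;
  (* the conditional distribution of y given x has variance sigma^2 *)
  pop_cond_var : forall b, exists2 m : p.-tuple R -> R,
    cond_expectation P (fun w => tuple_of_col (feature Sigma z w))
      (fun w => (y b w)%:E) (fun u => (m u)%:E) &
    cond_expectation P (fun w => tuple_of_col (feature Sigma z w))
      (fun w => ((y b w - m (tuple_of_col (feature Sigma z w))) ^+ 2)%:E)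
      (cst (sigma ^+ 2)%:E)
}.

(* n i.i.d. copies of (x, y), at each value [b] of the signal. *)
Record train_sample (n : nat) (Sigma : 'M[R]_p) (sigma : R)
    (z : 'I_n -> 'I_p -> {RV P >-> R})
    (y : 'cV[R]_p -> 'I_n -> {RV P >-> R}) : Prop := TrainSample {
  train_pop : forall i, population Sigma sigma (z i) (fun b => y b i);
  train_indep : forall b, mutually_independent P
    (fun i w => (tuple_of_col (feature Sigma (z i) w), y b i w : R));
  train_id : forall b, identically_distributed P
    (fun i w => (tuple_of_col (feature Sigma (z i) w), y b i w : R))
}.

Definition train_features (n : nat) (Sigma : 'M[R]_p)
    (z : 'I_n -> 'I_p -> {RV P >-> R}) (w : T) : 'M[R]_(n, p) :=
  \matrix_(i, j) feature Sigma (z i) w j 0.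

Definition train_responses (n : nat) (y : 'cV[R]_p -> 'I_n -> {RV P >-> R})
    (b : 'cV[R]_p) (w : T) : 'cV[R]_n :=
  \col_i y b i w.

Definition tuple_of_rows (n : nat) (X : 'M[R]_(n, p))
    : n.-tuple (p.-tuple R) :=
  [tuple tuple_of_col (row i X)^T | i < n].

(* E_{x0,y0}[(x0^T bhat - y0)^2] with the estimate [bhat] held fixed: the test
   point lives on its own probability space, hence is independent of the
   training data, and conditioning on these amounts to freezing [bhat]. *)
Definition ood_risk (Sigma0 : 'M[R]_p) (z0 : 'I_p -> {RV P >-> R})
    (y0 : 'cV[R]_p -> {RV P >-> R}) (b0 bhat : 'cV[R]_p) : \bar R :=
  'E_P[(fun w => (((feature Sigma0 z0 w)^T *m bhat) 0 0 - y0 b0 w) ^+ 2)%R]%E.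

End Model.

Record isotropic_signal (R : realType) (d : measure_display)
    (T : measurableType d) (P : probability T R) (p : nat) (alpha : R)
    (beta : T -> 'cV[R]_p) : Prop := IsotropicSignal {
  signal_measurable : forall j, measurable_fun [set: T] (fun t => beta t j 0);
  signal_second_moment : forall j k,
    'E_P[(fun t => beta t j 0 * beta t k 0)%R]%E =
    (((alpha ^+ 2 / p%:R)%:M : 'M[R]_p) j k)%:E
}.

(* Main.v *)
(** Deterministic part.  Write A(mu) = mu tr[Sigma0 (Sigma + mu)^-1] / p.  Along the
    curve lambda = lambda(mu) one has d lambda / d mu = 1 - phi tr[Sigma^2 (Sigma + mu)^-2] / p,
    and the beta-averaged equivalent equals
      sigma0^2 + alpha^2 (A + (lambda* - lambda) dA / d lambda),  lambda* = phi / SNR,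
    that is, the tangent at lambda to the strictly concave function A(lambda),
    extrapolated to lambda*.  It is therefore minimal exactly at lambda*, and strictly
    monotone on both sides of it, which also settles the limits at the endpoints.

    Finite-sample part.  The noise variance and the conditional variance of y given x
    agree, so E[y | x] = x^T beta almost surely.  By independence the noise is then
    centered and white conditionally on X, and the averaged conditional risk is a sum
    over the eigenvalues g of X^T X / n of positive multiples of
      (lambda^2 + lambda_p g) / (g + lambda)^2,
    each minimal at lambda = lambda_p. *)

Require Import Defs.
From HB Require Import structures.
From mathcomp Require Import all_boot all_order all_algebra.
From mathcomp Require Import spectral complex ring lra.
From mathcomp Require Import all_classical all_reals all_analysis.
From mathcomp Require Import measurable_realfun.

Set Implicit Arguments.
Unset Strict Implicit.
Unset Printing Implicit Defensive.

Import Order.TTheory GRing.Theory Num.Theory.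
Import numFieldNormedType.Exports.

Local Open Scope classical_set_scope.
Local Open Scope ring_scope.

(** * Spectral theorem for real symmetric matrices *)

(** The deterministic part uses no derivative: the second-order expansions of [pen] and [eff] are
    exact identities whose remainders have an evident sign, and all comparisons of tangents follow
    from them. In the finite-sample part the obstacle is integrability. The inverse of X^T X / n +
    lambda may be unbounded, so the conditional risk given X is computed only on events of designs
    where the determinant is nonzero and all weights are at most N; as N grows these events exhaust
    the designs of interest. The order of integration matters as well: the conditional moments of
    the noise are known at each fixed signal, so Tonelli's theorem moves the signal to the outer
    integral. Finally, versions of a conditional expectation may be infinite and cannot be
    subtracted; two of them are compared through their integrals over events on which rational
    levels separate them. *)

Lemma symmx_eigenvalue (R : rcfType) n (A : 'M[R]_n.+1) :
  A^T = A -> exists a, eigenvalue A a.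
Proof.
move=> sA; pose B := map_mx (real_complex R) A.
have Breal : B \is a mxOver Num.real.
  apply/mxOverP => i j; rewrite mxE complex_real//.
have hB : B \is hermsymmx.
  by apply: realsym_hermsym => //; apply/is_hermitianmxP; rewrite expr0 scale1r map_mx_id// /B map_trmx sA.
have := hermitian_spectral_diag_real hB.
have /hermitian_normalmx/orthomx_spectralP := hB.
set P := spectralmx B; set D := spectral_diag B => BE /mxOverP/(_ 0 0) Dr.
have uP : P \in unitmx by apply: spectral_unit.
have : eigenvalue B (D 0 0).
  apply/eigenvalueP; exists (row 0 P).
    have PB : P *m B = diag_mx D *m P by rewrite {1}BE !mulmxA mulmxV// mul1mx.
    by rewrite -row_mul PB row_mul row_diag_mx -scalemxAl -rowE.
  apply/negP => /eqP r0; have := congr1 (fun M => row 0 M *m invmx P) (erefl P).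
  rewrite {1}r0 mul0mx -row_mul mulmxV// => /rowP/(_ 0); rewrite !mxE /=.
  by move/eqP; rewrite eq_sym oner_eq0.
(* [B] and [A] share their characteristic polynomial up to the embedding of the reals, so a real
   root for [B] is a root for [A]. *)
rewrite eigenvalue_root_char -map_char_poly.
have -> : D 0 0 = real_complex R (complex.Re (D 0 0)).
  by rewrite RRe_real.
rewrite fmorph_root => rA; exists (complex.Re (D 0 0)).
by rewrite eigenvalue_root_char.
Qed.

Lemma dotmx_ge0 (R : realDomainType) n (v : 'rV[R]_n) : 0 <= (v *m v^T) 0 0.
Proof. by rewrite mxE sumr_ge0// => i _; rewrite mxE -expr2 sqr_ge0. Qed.

Lemma dotmx_eq0 (R : realDomainType) n (v : 'rV[R]_n) :
  ((v *m v^T) 0 0 == 0) = (v == 0).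
Proof.
apply/eqP/eqP => [|->]; last by rewrite mul0mx mxE.
rewrite mxE => /eqP; rewrite psumr_eq0 => [/allP v0|i _]; last first.
  by rewrite mxE -expr2 sqr_ge0.
apply/rowP => i; have := v0 i (mem_index_enum _).
by rewrite !mxE mulf_eq0 orbb => /eqP.
Qed.

(* Householder: reflect in the hyperplane orthogonal to [u - e_0]. *)
Lemma orthogonal_completion (R : rcfType) n (u : 'rV[R]_n.+1) :
  u *m u^T = 1%:M -> exists2 Q : 'M[R]_n.+1, Q *m Q^T = 1%:M & delta_mx 0 0 *m Q = u.
Proof.
move=> u1; have [->|ne] := eqVneq u (delta_mx 0 0).
  by exists 1%:M; rewrite ?trmx1 mulmx1.
pose w : 'rV_n.+1 := u - delta_mx 0 0; pose c : R := (w *m w^T) 0 0.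
have c0 : c != 0 by rewrite dotmx_eq0 subr_eq0.
have cE : c%:M = w *m w^T by rewrite [RHS]mx11_scalar.
have eu : delta_mx 0 0 *m u^T = (u 0 0)%:M.
  by rewrite -rowE [LHS]mx11_scalar !mxE.
have ee : delta_mx 0 0 *m (delta_mx 0 0 : 'rV[R]_n.+1)^T = 1%:M.
  by rewrite -rowE [LHS]mx11_scalar !mxE eqxx.
have ue : u *m (delta_mx 0 0 : 'rV[R]_n.+1)^T = (u 0 0)%:M.
  by rewrite -[LHS]trmxK trmx_mul trmxK eu tr_scalar_mx.
have cE2 : c = 2 - 2 * u 0 0.
  have := congr1 (fun M : 'M[R]_1 => M 0 0) cE.
  rewrite /w linearB /= mulmxBl !mulmxBr u1 eu ue ee !mxE eqxx !mulr1n => ->.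
  by ring.
(* As c = |u - e_0|^2 = 2 - 2 u_0, the product of e_0 with w is -c/2, and the reflection sends e_0
   to e_0 + w = u. *)
have ew : delta_mx 0 0 *m w^T = (- (c / 2))%:M.
  rewrite /w linearB /= mulmxBr eu ee cE2 -raddfB /=; congr (_%:M).
  by field.
have uE : u = delta_mx 0 0 + w by rewrite addrC subrK.
clearbody c w.
pose Q : 'M[R]_n.+1 := 1%:M - (2 / c) *: (w^T *m w).
have QT : Q^T = Q by rewrite /Q linearB /= linearZ /= trmx1 trmx_mul trmxK.
exists Q.
  rewrite QT /Q mulmxBl mul1mx mulmxBr mulmx1 -scalemxAl -scalemxAr.
  rewrite mulmxA -(mulmxA w^T) -cE mul_mx_scalar -scalemxAl !scalerA.
  by rewrite divfK// mulr_natr mulr2n scalerDl opprB addrK subrK.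
rewrite /Q mulmxBr mulmx1 -scalemxAr mulmxA ew mul_scalar_mx scalerA.
by rewrite mulrN mulrA divfK// divff ?pnatr_eq0// scaleN1r opprK uE.
Qed.

(** Deflation: complete a unit eigenvector to an orthogonal [P]. The first row of P A P^T is then a
    multiple of e_0, and by symmetry so is its first column, which leaves a smaller symmetric
    block. *)
Lemma symmx_spectral (R : rcfType) n (A : 'M[R]_n) : A^T = A ->
  exists Q : 'M[R]_n, exists s : 'rV_n, Q *m Q^T = 1%:M /\ A = Q^T *m diag_mx s *m Q.
Proof.
elim: n A => [|n IHn] A sA.
  by exists 1%:M, 0; split; apply/matrixP; case.
have [a /eigenvalueP[v va v0]] := symmx_eigenvalue sA.
pose k : R := (v *m v^T) 0 0.
have k0 : 0 < k by rewrite lt_def dotmx_eq0 v0 dotmx_ge0.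
pose u := (Num.sqrt k)^-1 *: v.
have u1 : u *m u^T = 1%:M.
  rewrite /u linearZ /= -scalemxAl -scalemxAr scalerA [v *m _]mx11_scalar -/k.
  by rewrite scale_scalar_mx -invfM -expr2 sqr_sqrtr ?ltW// mulVf// gt_eqF.
have ua : u *m A = a *: u by rewrite /u -scalemxAl va scalerA mulrC -scalerA.
have [P PP Pu] := orthogonal_completion u1.
have PTP : P^T *m P = 1%:M by exact: mulmx1C.
pose B : 'M[R]_(1 + n) := P *m A *m P^T.
have sB : B^T = B by rewrite /B !trmx_mul trmxK sA mulmxA.
have B0 : row 0 B = a *: delta_mx 0 0.
  by rewrite rowE /B !mulmxA Pu ua -scalemxAl -Pu -mulmxA PP mulmx1.
have PA : A = P^T *m B *m P.
  by rewrite /B !mulmxA PTP mul1mx -mulmxA PTP mulmx1.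
clearbody B.
have [Q [s [QQ BE]]] : exists Q : 'M[R]_n, exists s : 'rV_n,
    Q *m Q^T = 1%:M /\ drsubmx B = Q^T *m diag_mx s *m Q.
  by apply: IHn; rewrite trmx_drsub sB.
have BE' : B = block_mx a%:M 0 0 (drsubmx B).
  have u0 i : B 0 i = a * (i == 0)%:R.
    by move/rowP : B0 => /(_ i); rewrite !mxE /= => ->.
  rewrite -[LHS]submxK; congr block_mx.
  - rewrite [LHS]mx11_scalar !mxE !lshift0. by rewrite u0 eqxx mulr1.
  - by apply/rowP => j; rewrite !mxE !lshift0 u0 mulr0.
  - apply/colP => j; rewrite -sB !mxE !lshift0 u0 mulr0//.
pose Q1 : 'M[R]_(1 + n) := block_mx 1%:M 0 0 Q.
have Q1Q1 : Q1 *m Q1^T = 1%:M.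
  rewrite tr_block_mx mulmx_block !trmx0 trmx1 !mulmx0 !mul0mx !addr0 !add0r.
  by rewrite mul1mx QQ -scalar_mx_block.
have Q1B : B = Q1^T *m diag_mx (row_mx a%:M s) *m Q1.
  rewrite BE' BE tr_block_mx diag_mx_row !mulmx_block.
  rewrite !trmx0 trmx1 !mulmx0 !mul0mx !addr0 !add0r !mul1mx !mulmx1 !mul0mx.
  by congr block_mx; apply/matrixP => i j; rewrite !mxE !ord1 eqxx.
exists ((Q1 : 'M[R]_n.+1) *m P), (row_mx a%:M s : 'rV_n.+1); split.
  by rewrite trmx_mul mulmxA -(mulmxA _ P) PP mulmx1.
by rewrite {1}PA Q1B trmx_mul !mulmxA.
Qed.

(** * The deterministic equivalent in the spectral domain *)

Section Unimodal.
Variable R : realType.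
Variables (f : R -> R) (g : R -> \bar R) (a x : R).
Hypotheses (ax : a < x) (gE : forall l, a < l -> g l = (f l)%:E).
Hypothesis (decr : forall l1 l2, a < l1 -> l1 < l2 -> l2 <= x -> f l2 < f l1).
Hypothesis (incr : forall l1 l2, x <= l1 -> l1 < l2 -> f l1 < f l2).

Lemma unimodal_min_lt l : a < l -> l != x -> f x < f l.
Proof.
move=> al; have [lx|xl|->//] := ltgtP l x => _; last by rewrite incr.
by rewrite decr.
Qed.

(** By monotonicity the limit exists and is a supremum; the value at the midpoint of [a] and [x]
    keeps the inequality strict. *)
Lemma unimodal_lim_right : ((f x)%:E < lim (g r @[r --> a^'+]))%E.
Proof.
have m1 : a < (a + x) / 2 by have := ax; lra.
have m2 : (a + x) / 2 < x by have := ax; lra.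
have cg : g r @[r --> a^'+] -->
    ereal_sup [set g y | y in [set` Interval (BRight a) (BRight x)]].
  apply: nonincreasing_at_right_cvge; first by rewrite bnd_simp.
  move=> u v; rewrite !in_itv /= => /andP[au ux] /andP[av vx].
  rewrite le_eqVlt => /predU1P[->//|uv]; rewrite !gE// lee_fin ltW//.
  exact: decr.
rewrite (cvg_lim _ cg)//.
apply: (@lt_le_trans _ _ (f ((a + x) / 2))%:E).
  by rewrite lte_fin unimodal_min_lt// lt_eqF.
by apply: ereal_sup_ubound => /=; exists ((a + x) / 2); rewrite ?in_itv /= ?m1 ?ltW// gE.
Qed.

Lemma unimodal_lim_pinfty : ((f x)%:E < lim (g r @[r --> +oo%R]))%E.
Proof.
(* Clamping at [x] gives a function monotone on the whole line that agrees with [g] near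
   infinity. *)
pose h r := g (Num.max r x).
have hE r : h r = (f (Num.max r x))%:E by rewrite /h gE// lt_max ax orbT.
have ch : h r @[r --> +oo] --> ereal_sup (range h).
  apply: nondecreasing_cvge => u v uv; rewrite !hE lee_fin.
  have : Num.max u x <= Num.max v x by rewrite ge_max !le_max uv lexx orbT.
  rewrite le_eqVlt => /predU1P[->//|uv']; rewrite ltW// incr//.
  by rewrite le_max lexx orbT.
have cg : g r @[r --> +oo] --> ereal_sup (range h).
  apply: cvg_trans ch; apply: near_eq_cvg.
  near=> r; rewrite /h; congr g; apply/max_idPl.
  by near: r; apply: nbhs_pinfty_ge; rewrite num_real.
rewrite (cvg_lim _ cg)//.
apply: (@lt_le_trans _ _ (f (x + 1))%:E).
  by rewrite lte_fin unimodal_min_lt ?gt_eqF//; have := ax; lra.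
apply: ereal_sup_ubound => /=; exists (x + 1) => //; rewrite hE.
by congr (f _)%:E; apply/max_idPl; lra.
Unshelve. all: by end_near. Qed.

Lemma argmin_unimodal :
  argmin_on [set l : \bar R | (a%:E <= l)%E] (extend_to_endpoints a g) =
  [set x%:E].
Proof.
have gx : extend_to_endpoints a g x%:E = (f x)%:E.
  by rewrite /= gt_eqF// gE.
have minx l : (a%:E <= l)%E -> l != x%:E ->
    ((f x)%:E < extend_to_endpoints a g l)%E.
  case: l => [r| |]//=; last by move=> _ _; exact: unimodal_lim_pinfty.
  rewrite lee_fin eqe => ar rx; case: eqVneq => [_|ra].
    exact: unimodal_lim_right.
  have lar : a < r by rewrite lt_neqAle eq_sym ra.
  by rewrite gE// lte_fin unimodal_min_lt.
apply/seteqP; split => [l [al lmin]|_ ->].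
  apply/eqP; apply/negPn/negP => /(minx _ al).
  have /lmin : [set l : \bar R | (a%:E <= l)%E] x%:E by rewrite /= lee_fin ltW.
  by rewrite gx => /le_lt_trans h /h; rewrite ltxx.
split => [|v av]; first by rewrite /= lee_fin ltW.
have [->//|vx] := eqVneq v x%:E.
by rewrite gx ltW// minx.
Qed.

End Unimodal.

Lemma continuous_at_sum (R : realType) (I : finType) (F : I -> R -> R) (x : R) :
  (forall i, F i y @[y --> x] --> F i x) ->
  (fun y => \sum_i F i y) y @[y --> x] --> \sum_i F i x.
Proof.
move=> cF; elim: (index_enum I) => [|i r IHr].
  by rewrite big_nil; under eq_fun do rewrite big_nil; exact: cvg_cst.
rewrite big_cons; under eq_fun do rewrite big_cons.
by apply: cvgD; [exact: cF|exact: IHr].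
Qed.

(** * Scalar functions of mu built from the spectrum of Sigma *)

Section SpectralSums.
Variables (R : realType) (p : nat) (s c : 'I_p.+1 -> R) (phi : R).
Hypotheses (s0 : forall i, 0 < s i) (c0 : forall i, 0 < c i) (phi0 : 0 < phi).
Variable smin : R.
Hypotheses (smin_le : forall i, smin <= s i) (smin_at : exists i, s i = smin).

Let P : R := p.+1%:R.
Let P0 : 0 < P. Proof. by rewrite ltr0n. Qed.

(* In an eigenbasis of Sigma, [s] lists its eigenvalues and [c] the diagonal of
   Sigma0; [m] plays the role of mu.  [pen m] is the penalty lambda whose mu is
   [m], with derivative [1 - edf2 m]; [eff m] is mu tr[Sigma0 (Sigma + mu)^-1] / p,
   with derivative [eff' m]. *)
Definition edf2 m := phi * ((\sum_i s i ^+ 2 / (s i + m) ^+ 2) / P).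
Definition pen m := m - phi * ((\sum_i m * (s i / (s i + m))) / P).
Definition eff m := (\sum_i c i * (m / (s i + m))) / P.
Definition eff' m := (\sum_i c i * (s i / (s i + m) ^+ 2)) / P.

Let smin_gt0 : 0 < smin. Proof. by have [i <-] := smin_at. Qed.

Lemma den_gt0 m i : - smin < m -> 0 < s i + m.
Proof. by move=> sm; have := smin_le i; lra. Qed.

Let den_neq0 m i : - smin < m -> s i + m != 0.
Proof. by move=> sm; rewrite gt_eqF// den_gt0. Qed.

Lemma edf2_decr m1 m2 : - smin < m1 -> m1 < m2 -> edf2 m2 < edf2 m1.
Proof.
move=> sm m12; have sm2 := lt_trans sm m12.
rewrite /edf2 ltr_pM2l// ltr_pM2r ?invr_gt0//.
apply: ltr_sum => [|i _]; first by apply/hasP; exists ord0; rewrite ?mem_index_enum.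
rewrite ltr_pM2l ?exprn_gt0// ltf_pV2 ?posrE ?exprn_gt0 ?den_gt0//.
by rewrite ltrXn2r ?nnegrE ?ltW ?den_gt0// ltrD2l.
Qed.

Let cvg_den m i : - smin < m -> (s i + y)^-1 @[y --> m] --> (s i + m)^-1.
Proof.
move=> sm; apply: cvgV; first exact: den_neq0.
by apply: cvgD; [exact: cvg_cst|exact: cvg_id].
Qed.

Lemma edf2_continuous m : - smin < m -> edf2 y @[y --> m] --> edf2 m.
Proof.
move=> sm; apply: cvgMr; apply: cvgMl.
apply: continuous_at_sum => i; apply: cvgMr.
rewrite -exprVn (_ : (fun y => _) = (fun y => (s i + y)^-1 ^+ 2)); last first.
  by apply/funext => y; rewrite exprVn.
by rewrite expr2; apply: cvgM; exact: cvg_den.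
Qed.

Lemma pen_continuous m : - smin < m -> pen y @[y --> m] --> pen m.
Proof.
move=> sm; apply: cvgB; first exact: cvg_id.
apply: cvgMr; apply: cvgMl; apply: continuous_at_sum => i.
apply: cvgM; first exact: cvg_id.
by apply: cvgMr; exact: cvg_den.
Qed.

Lemma ratio_le1 i m : 0 <= m -> m / (s i + m) <= 1.
Proof.
by move=> m0; rewrite ler_pdivrMr ?ltr_pwDl// mul1r lerDr ltW.
Qed.

Lemma edf2_eq1 : exists2 m, - smin < m & edf2 m = 1.
Proof.
have [i0 si0] := smin_at.
(* Chosen so that at -smin + e the term of the smallest eigenvalue alone contributes phi/P * smin^2
   / e^2 = 1. *)
pose e := smin * Num.sqrt (phi / P).
have e0 : 0 < e by rewrite mulr_gt0// sqrtr_gt0 divr_gt0.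
pose m1 := - smin + e.
have sm1 : - smin < m1 by rewrite /m1; lra.
have le1 : 1 <= edf2 m1.
  rewrite /edf2 mulrA mulrAC (bigD1 i0)//= si0 {1}/m1 addrA subrr add0r /e exprMn sqr_sqrtr; last by rewrite divr_ge0 ?ltW.
  rewrite mulrDr (_ : phi / P * (smin ^+ 2 / _) = 1); last first.
    by field; rewrite ?gt_eqF.
  rewrite lerDl; apply: mulr_ge0; first by rewrite divr_ge0 ?ltW.
  by apply: sumr_ge0 => i _; rewrite divr_ge0 ?sqr_ge0.
pose S := \sum_i s i; have S0 : 0 <= S by apply: sumr_ge0 => i _; exact: ltW.
(* For m > 0 one has s^2 / (s + m)^2 <= s / m, so [edf2 m] is at most phi/P * S / m, hence at most 1
   at [m2]. *)
pose m2 := Num.max m1 (1 + phi / P * S).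
have m20 : 0 < m2.
  rewrite lt_max; apply/orP; right; apply: ltr_pwDl => //.
  by apply: mulr_ge0 => //; rewrite divr_ge0 ?ltW.
have m12 : m1 <= m2 by rewrite le_max lexx.
have ge1 : edf2 m2 <= 1.
  apply: (@le_trans _ _ (phi / P * S / m2)).
    rewrite /edf2 mulrA mulrAC -[leRHS]mulrA ler_pM2l ?divr_gt0//.
    rewrite /S mulr_suml ler_sum// => i _.
    have d0 : 0 < s i + m2 by rewrite addr_gt0.
    rewrite ler_pdivrMr ?exprn_gt0// mulrAC ler_pdivlMr//.
    rewrite expr2 -mulrA ler_pM2l//; nra.
  by rewrite ler_pdivrMr// mul1r le_max; apply/orP; right; rewrite lerDr.
have [||m] := @IVT _ edf2 m1 m2 1 m12.
- apply: continuous_in_subspaceT => m; rewrite inE /= in_itv /= => /andP[mm _].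
  by apply: edf2_continuous; exact: lt_le_trans mm.
- by rewrite ge_min ge1 orbT/= le_max le1.
rewrite in_itv /= => /andP[mm _] E; exists m => //.
exact: lt_le_trans mm.
Qed.

Variable m0 : R.
Hypotheses (sm0 : - smin < m0) (edf2m0 : edf2 m0 = 1).

Let sm m : m0 <= m -> - smin < m. Proof. exact: lt_le_trans. Qed.

Lemma edf2_lt1 m : m0 < m -> edf2 m < 1.
Proof. by move=> mm; rewrite -edf2m0 edf2_decr. Qed.

(** A Taylor expansion with exact remainder: it holds termwise as an identity of rational functions.
    The positive remainder makes [pen] strictly convex. *)
Lemma pen_tangent m m' : - smin < m -> - smin < m' ->
  pen m' = pen m + (1 - edf2 m) * (m' - m) +
    (m' - m) ^+ 2 * (phi * ((\sum_i s i ^+ 2 / ((s i + m) ^+ 2 * (s i + m'))) / P)).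
Proof.
move=> h h'; rewrite /pen /edf2.
have -> : \sum_i m' * (s i / (s i + m')) =
    \sum_i m * (s i / (s i + m)) + (m' - m) * \sum_i s i ^+ 2 / (s i + m) ^+ 2 -
    (m' - m) ^+ 2 * \sum_i s i ^+ 2 / ((s i + m) ^+ 2 * (s i + m')).
  rewrite !mulr_sumr -big_split -sumrB /=; apply: eq_bigr => i _.
  by field; rewrite !den_neq0.
by field; rewrite gt_eqF.
Qed.

Let rem_gt0 (d : 'I_p.+1 -> R) m m' : (forall i, 0 < d i) ->
  - smin < m -> - smin < m' ->
  0 < (\sum_i d i / ((s i + m) ^+ 2 * (s i + m'))) / P.
Proof.
move=> d0 h h'; have t0 i : 0 < d i / ((s i + m) ^+ 2 * (s i + m')).
  by rewrite divr_gt0// mulr_gt0 ?exprn_gt0 ?den_gt0.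
rewrite divr_gt0// (bigD1 ord0)//= ltr_pwDl//.
by apply: sumr_ge0 => i _; exact: ltW.
Qed.

Lemma pen_ge_tangent m m' : - smin < m -> - smin < m' -> m != m' ->
  pen m + (1 - edf2 m) * (m' - m) < pen m'.
Proof.
move=> h h' mm'; rewrite [ltRHS](pen_tangent h h') ltrDl mulr_gt0//.
  by rewrite exprn_even_gt0//= subr_eq0 eq_sym.
by rewrite mulr_gt0// rem_gt0// => i; rewrite exprn_gt0.
Qed.

Lemma pen_incr m1 m2 : m0 <= m1 -> m1 < m2 -> pen m1 < pen m2.
Proof.
move=> h h'; have := pen_ge_tangent (sm h) (sm (ltW (le_lt_trans h h'))).
rewrite lt_eqF// => /(_ isT); apply: le_lt_trans.
rewrite lerDl mulr_ge0 ?subr_ge0 ?(ltW h')//.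
by move: h; rewrite le_eqVlt => /predU1P[<-|/edf2_lt1/ltW//]; rewrite edf2m0.
Qed.

(** The slope of the convex [pen] vanishes at [m0], so [pen m0] is its minimum, while [pen 0 = 0].
    This places lambda_min below the positive target penalty. *)
Lemma pen_m0_le0 : pen m0 <= 0.
Proof.
have p0 : pen 0 = 0.
  by rewrite /pen big1 ?mul0r ?mulr0 ?subr0// => i _; rewrite mul0r.
have [->|z] := eqVneq m0 0; first by rewrite p0.
rewrite -p0; have /(_ _ z) := pen_ge_tangent sm0 (_ : - smin < 0).
by rewrite edf2m0 subrr mul0r addr0 oppr_lt0 => /(_ smin_gt0)/ltW.
Qed.

Lemma pen_surj l : pen m0 < l -> exists2 m, m0 < m & pen m = l.
Proof.
move=> ml; pose S := \sum_i s i; have S0 : 0 <= S by apply: sumr_ge0 => i _; exact: ltW.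
(* For m >= 0 each m / (s + m) is at most 1, so [pen m] is at least m - phi * S / P, which reaches
   [l] at [m2]. *)
pose m2 := Num.max m0 (Num.max 0 (l + phi * (S / P))).
have m02 : m0 <= m2 by rewrite le_max lexx.
have m20 : 0 <= m2 by rewrite !le_max lexx orbT.
have lm2 : l + phi * (S / P) <= m2 by rewrite !le_max lexx !orbT.
have lp : l <= pen m2.
  rewrite /pen lerBrDr; apply: le_trans lm2; rewrite lerD2l ler_pM2l// ler_pM2r ?invr_gt0//.
  rewrite ler_sum// => i _; rewrite mulrCA ler_piMr ?ratio_le1// ltW//.
have [||m] := @IVT _ pen m0 m2 l m02.
- apply: continuous_in_subspaceT => m; rewrite inE /= in_itv /= => /andP[mm _].
  exact/pen_continuous/sm.
- by rewrite ge_min (ltW ml) /= le_max lp orbT.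
rewrite in_itv /= => /andP[mm _] E; exists m => //.
rewrite lt_neqAle mm andbT; apply/eqP => E0; move: ml; rewrite E0 E ltxx//.
Qed.

(** By the chain rule, the derivative of [eff] with respect to the penalty [pen]; [phi * slope m] is
    the quantity [vtilde]. *)
Definition slope m := eff' m / (1 - edf2 m).

Lemma eff_tangent m m' : - smin < m -> - smin < m' ->
  eff m' = eff m + eff' m * (m' - m) -
    (m' - m) ^+ 2 * ((\sum_i (c i * s i) / ((s i + m) ^+ 2 * (s i + m'))) / P).
Proof.
move=> h h'; rewrite /eff /eff'.
have -> : \sum_i c i * (m' / (s i + m')) =
    \sum_i c i * (m / (s i + m)) + (m' - m) * \sum_i c i * (s i / (s i + m) ^+ 2) -
    (m' - m) ^+ 2 * \sum_i c i * s i / ((s i + m) ^+ 2 * (s i + m')).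
  rewrite !mulr_sumr -big_split -sumrB /=; apply: eq_bigr => i _.
  by field; rewrite !den_neq0.
by field; rewrite gt_eqF.
Qed.

(* As functions of the penalty [pen m], the tangents to [eff] lie above it. *)
Lemma eff_lt_tangent m m' : m0 < m -> m0 < m' -> m != m' ->
  eff m' < eff m + (pen m' - pen m) * slope m.
Proof.
move=> h h' mm'; have hs := sm (ltW h); have hs' := sm (ltW h').
have D0 : 0 < 1 - edf2 m by rewrite subr_gt0 edf2_lt1.
have e0 : 0 <= eff' m.
  apply: divr_ge0; last exact: ltW.
  apply: sumr_ge0 => i _.
  by apply: mulr_ge0; rewrite ?divr_ge0 ?sqr_ge0// ltW.
(* Concavity of [eff] in mu bounds it by its tangent in mu. Convexity of [pen] then bounds m' - m by
   (pen m' - pen m) / (1 - edf2 m), and [eff'] is nonnegative. *)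
apply: (@lt_le_trans _ _ (eff m + eff' m * (m' - m))).
  rewrite [ltLHS](eff_tangent hs hs') gtrDl oppr_lt0 mulr_gt0//.
    by rewrite exprn_even_gt0//= subr_eq0 eq_sym.
  by rewrite rem_gt0// => i; rewrite mulr_gt0.
rewrite lerD2l /slope mulrCA ler_wpM2l// ler_pdivlMr// mulrC.
have := ltW (pen_ge_tangent hs hs' mm'); lra.
Qed.

Variable ms : R.
Hypothesis (m0s : m0 < ms).

(* The tangent at [m] to [eff], as a function of the penalty, evaluated at the
   penalty [pen ms]: the averaged risk is an affine function of this. *)
Definition tangent m := eff m + (pen ms - pen m) * slope m.

(** Adding the two tangent inequalities between [m1] and [m2] gives (pen m2 - pen m1) * (slope m1 -
    slope m2) > 0. *)
Let slope_decr m1 m2 : m0 < m1 -> m1 < m2 -> slope m2 < slope m1.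
Proof.
move=> h1 h12; have h2 := lt_trans h1 h12.
have := eff_lt_tangent h1 h2; rewrite lt_eqF// => /(_ isT).
have := eff_lt_tangent h2 h1; rewrite gt_eqF// => /(_ isT).
have := pen_incr (ltW h1) h12; nra.
Qed.

(** The tangent at [m1] exceeds [eff] at [m2], and from there to [pen ms] it rises with the larger
    slope. To the right of [ms] the same comparison runs backwards. *)
Lemma tangent_decr m1 m2 : m0 < m1 -> m1 < m2 -> m2 <= ms ->
  tangent m2 < tangent m1.
Proof.
move=> h1 h12 h2s; have h2 := lt_trans h1 h12.
have := slope_decr h1 h12.
have := eff_lt_tangent h1 h2; rewrite lt_eqF// => /(_ isT).
have : pen m2 <= pen ms.
  by move: h2s; rewrite le_eqVlt => /predU1P[->//|/(pen_incr (ltW h2))/ltW].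
rewrite /tangent; nra.
Qed.

Lemma tangent_incr m1 m2 : ms <= m1 -> m1 < m2 -> tangent m1 < tangent m2.
Proof.
move=> hs1 h12; have h1 := lt_le_trans m0s hs1; have h2 := lt_trans h1 h12.
have := slope_decr h1 h12.
have := eff_lt_tangent h2 h1; rewrite gt_eqF// => /(_ isT).
have : pen ms <= pen m1.
  by move: hs1; rewrite le_eqVlt => /predU1P[->//|/(pen_incr (ltW m0s))/ltW].
rewrite /tangent; nra.
Qed.

End SpectralSums.

(** * Functional calculus *)

(** Values are indexed by eigenvectors rather than given as a function of the eigenvalue, so every
    matrix diagonal in the basis [Q] has this form. *)
Definition fcalc (R : rcfType) n (Q : 'M[R]_n) (f : 'I_n -> R) : 'M[R]_n :=
  Q^T *m diag_mx (\row_i f i) *m Q.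

Section FunctionalCalculus.
Variables (R : rcfType) (n : nat) (Q : 'M[R]_n).
Hypothesis QQ : Q *m Q^T = 1%:M.
Implicit Types (f g : 'I_n -> R) (C : 'M[R]_n).

Let QTQ : Q^T *m Q = 1%:M. Proof. exact: mulmx1C. Qed.

Lemma eq_fcalc f g : f =1 g -> fcalc Q f = fcalc Q g.
Proof. by move=> /funext ->. Qed.

Lemma fcalcM f g : fcalc Q f *m fcalc Q g = fcalc Q (fun i => f i * g i).
Proof.
rewrite /fcalc !mulmxA -(mulmxA _ Q) QQ mulmx1 -(mulmxA Q^T).
rewrite mulmx_diag; congr (_ *m diag_mx _ *m _).
by apply/rowP => i; rewrite !mxE.
Qed.

Lemma fcalcD f g : fcalc Q f + fcalc Q g = fcalc Q (fun i => f i + g i).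
Proof.
rewrite /fcalc -mulmxDl -mulmxDr -raddfD /=; congr (_ *m diag_mx _ *m _).
by apply/rowP => i; rewrite !mxE.
Qed.

Lemma fcalcZ a f : a *: fcalc Q f = fcalc Q (fun i => a * f i).
Proof.
rewrite /fcalc scalemxAl scalemxAr -linearZ /=; congr (_ *m diag_mx _ *m _).
by apply/rowP => i; rewrite !mxE.
Qed.

Lemma fcalc_scalar a : a%:M = fcalc Q (fun=> a).
Proof.
rewrite /fcalc (_ : \row__ _ = const_mx a); last by apply/rowP => i; rewrite !mxE.
by rewrite diag_const_mx mul_mx_scalar -scalemxAl QTQ scalemx1.
Qed.

Lemma fcalc_tr f : (fcalc Q f)^T = fcalc Q f.
Proof. by rewrite /fcalc !trmx_mul trmxK tr_diag_mx mulmxA. Qed.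

Lemma fcalcV_mul f : (forall i, f i != 0) ->
  fcalc Q f *m fcalc Q (fun i => (f i)^-1) = 1%:M.
Proof.
move=> f0; rewrite fcalcM (fcalc_scalar 1).
by apply: eq_fcalc => i; rewrite divff.
Qed.

Lemma fcalc_unit f : (forall i, f i != 0) -> fcalc Q f \in unitmx.
Proof. by move=> /fcalcV_mul /mulmx1_unit[]. Qed.

Lemma fcalcV f : (forall i, f i != 0) ->
  invmx (fcalc Q f) = fcalc Q (fun i => (f i)^-1).
Proof.
move=> f0; rewrite -[LHS]mulmx1 -(fcalcV_mul f0) mulKmx//.
exact: fcalc_unit.
Qed.

(** This is how Sigma0 enters without commuting with Sigma: under the trace only the diagonal of [C]
    in the eigenbasis counts. *)
Lemma trace_fcalc C f :
  \tr (C *m fcalc Q f) = \sum_i (Q *m C *m Q^T) i i * f i.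
Proof.
rewrite /fcalc mulmxA mxtrace_mulC !mulmxA /mxtrace; apply: eq_bigr => i _.
by rewrite mul_mx_diag !mxE.
Qed.

Lemma qform_fcalc f (u : 'cV[R]_n) :
  (u^T *m fcalc Q f *m u) 0 0 = \sum_i f i * ((Q *m u) i 0) ^+ 2.
Proof.
rewrite /fcalc !mulmxA -mulmxA -trmx_mul mul_mx_diag mxE; apply: eq_bigr => i _.
by rewrite !mxE expr2; ring.
Qed.

Lemma eigenvalue_fcalc f i : eigenvalue (fcalc Q f) (f i).
Proof.
apply/eigenvalueP; exists (row i Q).
  by rewrite /fcalc !mulmxA -row_mul QQ -row_mul mul1mx -row_mul row_mul row_diag_mx mxE -scalemxAl -rowE.
apply/eqP => ri; have := congr1 (fun M : 'rV_n => M *m Q^T) ri.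
rewrite -row_mul QQ mul0mx => /rowP/(_ i); rewrite !mxE eqxx.
by move/eqP; rewrite oner_eq0.
Qed.

Lemma eigenvalue_fcalcP f a : eigenvalue (fcalc Q f) a -> exists i, f i = a.
Proof.
move=> /eigenvalueP[v va v0]; apply: contrapT => /forallNP fa.
have /fcalc_unit u : forall i, f i - a != 0.
  by move=> i; rewrite subr_eq0; apply/eqP/fa.
have : v *m fcalc Q (fun i => f i - a) = 0.
  by rewrite -fcalcD -fcalc_scalar mulmxDr va mul_mx_scalar scaleNr subrr.
move=> /(congr1 (fun M : 'rV_n => M *m invmx (fcalc Q (fun i => f i - a)))).
by rewrite mulmxK// mul0mx => v00; rewrite v00 eqxx in v0.
Qed.

Lemma posdef_conj_diag C i :
  (forall u : 'cV_n, u != 0 -> 0 < (u^T *m C *m u) 0 0) ->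
  0 < (Q *m C *m Q^T) i i.
Proof.
move=> /(_ (row i Q)^T); rewrite trmxK => h.
suff -> : (Q *m C *m Q^T) i i = (row i Q *m C *m (row i Q)^T) 0 0.
  apply: h; apply/eqP => /(congr1 trmx); rewrite trmxK trmx0 => ri.
  have := congr1 (fun M : 'rV_n => M *m Q^T) ri.
  rewrite -row_mul QQ mul0mx => /rowP/(_ i); rewrite !mxE eqxx.
  by move/eqP; rewrite oner_eq0.
by rewrite -row_mul [LHS]mxE [RHS]mxE; apply: eq_bigr => j _; rewrite !mxE.
Qed.

End FunctionalCalculus.

Lemma symmx_fcalc (R : rcfType) n (A : 'M[R]_n) : A^T = A ->
  exists Q, exists s, Q *m Q^T = 1%:M /\ A = fcalc Q s.
Proof.
move=> /symmx_spectral[Q [s [QQ ->]]]; exists Q, (fun i => s 0 i); split => //.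
rewrite /fcalc; congr (_ *m diag_mx _ *m _).
by apply/rowP => i; rewrite mxE.
Qed.

(** * Positive definite matrices, square roots and inverses *)

Section PositiveMatrices.
Variables (R : realType) (p : nat).
Implicit Type A : 'M[R]_p.

Lemma fcalc_posdef (Q : 'M[R]_p) s : Q *m Q^T = 1%:M -> (forall i, 0 < s i) ->
  posdefmx (fcalc Q s).
Proof.
move=> QQ s0; split => [|u u0]; first exact: fcalc_tr.
rewrite qform_fcalc//; rewrite lt_def sumr_ge0 ?andbT => [|i _]; last first.
  by rewrite mulr_ge0 ?sqr_ge0 ?ltW.
apply: contra u0 => /eqP/eqP; rewrite psumr_eq0 => [/allP q0|i _]; last first.
  by rewrite mulr_ge0 ?sqr_ge0 ?ltW.
rewrite -[u]mul1mx -(mulmx1C QQ) -mulmxA; apply/eqP.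
rewrite [X in _ *m X](_ : _ = 0) ?mulmx0//; apply/colP => i; rewrite [RHS]mxE.
have := q0 i (mem_index_enum _); rewrite mulf_eq0 gt_eqF//= sqrf_eq0.
by move/eqP.
Qed.

Lemma posdefmx_eigen A : A^T = A -> (forall a, eigenvalue A a -> 0 < a) ->
  posdefmx A.
Proof.
move=> /symmx_fcalc[Q [s [QQ ->]]] h; apply: fcalc_posdef => // i.
exact/h/eigenvalue_fcalc.
Qed.

Lemma posdefmx_fcalc (Q : 'M[R]_p) s : Q *m Q^T = 1%:M -> posdefmx (fcalc Q s) ->
  forall i : 'I_p, 0 < s i.
Proof.
move=> QQ [_ h] i; have := posdef_conj_diag QQ i h.
rewrite /fcalc !mulmxA QQ mul1mx -mulmxA QQ mulmx1 !mxE eqxx mulr1n.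
by [].
Qed.

Lemma posdefmx_unit A : posdefmx A -> A \in unitmx.
Proof.
move=> hA; have [Q [s [QQ AE]]] := symmx_fcalc hA.1; rewrite AE in hA *.
by apply: fcalc_unit => // i; rewrite gt_eqF// (posdefmx_fcalc QQ hA).
Qed.

Lemma sqrtmxP A : posdefmx A -> psdmx (sqrtmx A) /\ sqrtmx A *m sqrtmx A = A.
Proof.
move=> hA; suff : exists B, [set B : 'M[R]_p | psdmx B /\ B *m B = A] B.
  by move=> h; exact: (xgetPex 0 h).
have [Q [s [QQ AE]]] := symmx_fcalc hA.1.
rewrite AE in hA *; have s0 := posdefmx_fcalc QQ hA.
exists (fcalc Q (fun i => Num.sqrt (s i))) => /=; split.
  split => [|u]; first exact: fcalc_tr.
  by rewrite qform_fcalc// sumr_ge0// => i _; rewrite mulr_ge0 ?sqr_ge0 ?sqrtr_ge0.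
rewrite fcalcM//; apply: eq_fcalc => i.
by rewrite -expr2 sqr_sqrtr// ltW.
Qed.

(** The inverse solves the four Penrose equations, so [mpinv A] is a solution too; cancelling [A] on
    both sides of the first one identifies it. *)
Lemma mpinv_unit A : A \in unitmx -> mpinv A = invmx A.
Proof.
move=> uA; have : [set B : 'M[R]_p | [/\ A *m B *m A = A, B *m A *m B = B,
    (A *m B)^T = A *m B & (B *m A)^T = B *m A]] (invmx A).
  by split; rewrite ?mulmxV ?mulVmx ?mul1mx ?trmx1.
move=> h; have [e _ _ _] := xgetPex 0 (ex_intro _ _ h).
rewrite -/(mpinv A) in e.
rewrite -[LHS]mul1mx -(mulVmx uA) -[LHS]mulmx1 -(mulmxV uA).
by rewrite -!mulmxA (mulmxA (mpinv A)) (mulmxA A) (mulmxA A) e mulKmx.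
Qed.

End PositiveMatrices.

(** * Expectations of real random variables *)

Section RealExpectation.
Variables (R : realType) (d : measure_display) (T : measurableType d).
Variable P : probability T R.
Implicit Types f g : T -> R.

Definition intble f := P.-integrable [set: T] (EFin \o f).

Definition Ex f : R := \int[P]_w f w.

Lemma ExE f : intble f -> (\int[P]_w (f w)%:E)%E = (Ex f)%:E.
Proof. by move=> h; rewrite /Ex /Rintegral fineK//; exact: integrable_fin_num. Qed.

Lemma intble_meas f : intble f -> measurable_fun [set: T] f.
Proof. by move=> /measurable_int/measurable_EFinP. Qed.

Lemma eq_Ex f g : f =1 g -> Ex f = Ex g.
Proof. by move=> /funext ->. Qed.

Lemma eq_intble f g : f =1 g -> intble f -> intble g.
Proof. by move=> /funext ->. Qed.

Lemma intble_le f g : measurable_fun [set: T] f -> (forall w, `|f w| <= `|g w|) ->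
  intble g -> intble f.
Proof.
move=> mf fg; apply: le_integrable => //; first exact/measurable_EFinP.
by move=> w _ /=; rewrite lee_fin.
Qed.

Lemma intble_cst c : intble (fun=> c).
Proof. exact: finite_measure_integrable_cst. Qed.

Lemma intbleD f g : intble f -> intble g -> intble (fun w => f w + g w).
Proof. by move=> hf hg; exact: (integrableD measurableT hf hg). Qed.

Lemma intbleZ c f : intble f -> intble (fun w => c * f w).
Proof. by move=> hf; exact: (integrableZl measurableT c hf). Qed.

Lemma intbleB f g : intble f -> intble g -> intble (fun w => f w - g w).
Proof. by move=> hf hg; exact: (integrableB measurableT hf hg). Qed.

Lemma intble_sum (I : finType) (F : I -> T -> R) : (forall i, intble (F i)) ->
  intble (fun w => \sum_i F i w).
Proof.
move=> iF; elim: (index_enum I) => [|i r IHr].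
  by apply: eq_intble (intble_cst 0) => w; rewrite big_nil.
by apply: eq_intble (intbleD (iF i) IHr) => w; rewrite big_cons.
Qed.

Lemma Ex_cst c : Ex (fun=> c) = c.
Proof. by rewrite /Ex Rintegral_cst//= [X in fine X]probability_setT mulr1. Qed.

Lemma ExD f g : intble f -> intble g -> Ex (fun w => f w + g w) = Ex f + Ex g.
Proof. by move=> hf hg; exact: RintegralD. Qed.

Lemma ExB f g : intble f -> intble g -> Ex (fun w => f w - g w) = Ex f - Ex g.
Proof. by move=> hf hg; exact: RintegralB. Qed.

Lemma ExZ c f : intble f -> Ex (fun w => c * f w) = c * Ex f.
Proof. by move=> hf; exact: RintegralZl. Qed.

Lemma Ex_sum (I : finType) (F : I -> T -> R) : (forall i, intble (F i)) ->
  Ex (fun w => \sum_i F i w) = \sum_i Ex (F i).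
Proof.
move=> iF; suff : intble (fun w => \sum_i F i w) /\
    Ex (fun w => \sum_i F i w) = \sum_i Ex (F i) by case.
elim: (index_enum I) => [|i r [ir IHr]].
  rewrite big_nil; under eq_fun do rewrite big_nil.
  by rewrite Ex_cst; split => //; exact: intble_cst.
rewrite big_cons; under eq_fun do rewrite big_cons.
by rewrite ExD// IHr; split => //; exact: intbleD.
Qed.

Lemma le_Ex f g : intble f -> intble g -> (forall w, f w <= g w) -> Ex f <= Ex g.
Proof. by move=> hf hg fg; apply: le_Rintegral. Qed.

Lemma intble_bounded_mul (c : R) f g : measurable_fun [set: T] f ->
  (forall w, `|f w| <= c) -> intble g -> intble (fun w => f w * g w).
Proof.
move=> mf fc hg; apply: (@intble_le _ (fun w => c * g w)).
- by apply: measurable_funM => //; exact: intble_meas.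
- move=> w; rewrite !normrM ler_wpM2r//.
  by apply: le_trans (ler_norm c); exact: fc.
- exact: intbleZ.
Qed.

Lemma intble_indic (A : set T) f : measurable A -> intble f ->
  intble (fun w => \1_A w * f w).
Proof.
move=> mA; apply: (@intble_bounded_mul 1); first exact: measurable_indic.
by move=> w; rewrite indicE; case: (_ \in _); rewrite ?normr1 ?normr0.
Qed.

Lemma Ex_indic (A : set T) : measurable A -> Ex (\1_A) = fine (P A).
Proof. by move=> mA; rewrite /Ex /Rintegral integral_indic// setIT. Qed.

Lemma integral_in_Ex (A : set T) f : measurable A -> intble f ->
  (\int[P]_(w in A) (f w)%:E)%E = (Ex (fun w => \1_A w * f w))%:E.
Proof.
move=> mA hf; rewrite -ExE; last exact: intble_indic.
rewrite integral_mkcond; apply: eq_integral => w _; rewrite patchE indicE.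
by case: (_ \in _); rewrite ?mul1r ?mul0r.
Qed.

Definition sqint f := measurable_fun [set: T] f /\ intble (fun w => f w ^+ 2).

Lemma sqintM f g : sqint f -> sqint g -> intble (fun w => f w * g w).
Proof.
move=> [mf hf] [mg hg]; apply: (@intble_le _ (fun w => f w ^+ 2 + g w ^+ 2)).
- exact: measurable_funM.
- move=> w; rewrite normrM [leRHS]ger0_norm ?addr_ge0 ?sqr_ge0//.
  rewrite -(real_normK (num_real (f w))) -(real_normK (num_real (g w))).
  move: `|f w| `|g w| => u v; rewrite -subr_ge0.
  have -> : u ^+ 2 + v ^+ 2 - u * v = 3 / 4 * (u - v) ^+ 2 + 1 / 4 * (u + v) ^+ 2.
    by field.
  by rewrite addr_ge0// mulr_ge0// sqr_ge0.
- exact: intbleD.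
Qed.

Lemma sqint_cst c : sqint (fun=> c).
Proof. by split => //; exact: intble_cst. Qed.

Lemma sqint_intble f : sqint f -> intble f.
Proof.
move=> hf; have := sqintM (sqint_cst 1) hf.
by apply: eq_intble => w; rewrite mul1r.
Qed.

Lemma sqintZ c f : sqint f -> sqint (fun w => c * f w).
Proof.
move=> [mf hf]; split; first exact: measurable_funM.
by apply: eq_intble (intbleZ (c ^+ 2) hf) => w; rewrite exprMn.
Qed.

Lemma sqintD f g : sqint f -> sqint g -> sqint (fun w => f w + g w).
Proof.
move=> hf hg; split; first by apply: measurable_funD; [case: hf|case: hg].
have := intbleD (intbleD hf.2 hg.2) (intbleZ 2 (sqintM hf hg)).
by apply: eq_intble => w; ring.
Qed.

Lemma sqintB f g : sqint f -> sqint g -> sqint (fun w => f w - g w).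
Proof.
move=> hf hg; have := sqintD hf (sqintZ (-1) hg).
by rewrite (_ : (fun w => _ + _) = (fun w => f w - g w))//; apply/funext => w; rewrite mulN1r.
Qed.

Lemma sqint_sum (I : finType) (F : I -> T -> R) : (forall i, sqint (F i)) ->
  sqint (fun w => \sum_i F i w).
Proof.
move=> iF; elim: (index_enum I) => [|i r IHr].
  by under eq_fun do rewrite big_nil; exact: sqint_cst.
by under eq_fun do rewrite big_cons; exact: sqintD.
Qed.

Lemma sqint_fin f : measurable_fun [set: T] f ->
  (\int[P]_w (f w ^+ 2)%:E < +oo)%E -> sqint f.
Proof.
move=> mf hf; split => //; apply/integrableP; split.
  by apply/measurable_EFinP; exact: measurable_funX.
by under eq_integral do rewrite /= ger0_norm ?sqr_ge0//.
Qed.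

Import HBNNSimple.

(* The hypothesis on the events [X \in B] says that E[f | X] = 0. *)
Lemma Ex_orthogonal (d' : measure_display) (U : measurableType d') (X : T -> U)
    (a : U -> R) f :
  measurable_fun [set: T] X -> measurable_fun [set: U] a -> intble f ->
  (forall B, measurable B -> Ex (fun w => \1_B (X w) * f w) = 0) ->
  intble (fun w => a (X w) * f w) ->
  Ex (fun w => a (X w) * f w) = 0.
Proof.
(* Positive and negative parts are dominated by [a], so both products with [f] stay integrable. *)
move=> mX; wlog a0 : a / forall u, 0 <= a u.
  move=> W ma hf f0 af.
  have mp : measurable_fun [set: U] (a^\+)%R by exact: measurable_funrpos.
  have mn : measurable_fun [set: U] (a^\-)%R by exact: measurable_funrneg.
  have dom (b : U -> R) : measurable_fun [set: U] b ->
      (forall u, `|b u| <= `|a u|) -> intble (fun w => b (X w) * f w).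
    move=> mb ba; apply: intble_le af; last by move=> w; rewrite !normrM ler_wpM2r.
    apply: measurable_funM; last exact: intble_meas.
    exact: measurableT_comp.
  have ip : intble (fun w => a^\+ (X w) * f w).
    apply: dom => // u; rewrite ger0_norm ?funrpos_ge0// /funrpos.
    by rewrite ge_max ler_norm normr_ge0.
  have iN : intble (fun w => a^\- (X w) * f w).
    apply: dom => // u; rewrite ger0_norm ?funrneg_ge0// /funrneg.
    by rewrite ge_max normr_ge0 andbT -normrN ler_norm.
  have -> : (fun w => a (X w) * f w) = (fun w => a^\+ (X w) * f w - a^\- (X w) * f w).
    by apply/funext => w; rewrite -mulrBl -{1}[a]funrposBneg.
  rewrite ExB// [X in X - _](W _ _ mp)// ?[X in _ - X](W _ _ mn)// ?subrr//.
move=> ma hf f0 af; pose ea : U -> \bar R := EFin \o a.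
have mea : measurable_fun [set: U] ea by exact/measurable_EFinP.
(* For a simple function the claim is the hypothesis applied to its level sets; dominated
   convergence with bound |a(X) f| then passes to the limit. *)
pose an := nnsfun_approx measurableT mea.
have ea0 u : [set: U] u -> (0 <= ea u)%E by rewrite lee_fin a0.
have an_le n u : an n u <= a u.
  by rewrite -lee_fin /an nnsfun_approxE; exact: le_approx ea0 _.
have an0 n u : 0 <= an n u by [].
have an_int n : intble (fun w => an n (X w) * f w).
  apply: intble_le af.
    apply: measurable_funM; last exact: intble_meas.
    exact: measurableT_comp.
  by move=> w; rewrite !normrM ler_wpM2r// !ger0_norm.
have an_Ex n : Ex (fun w => an n (X w) * f w) = 0.
  have mi (r : R) : measurable (an n @^-1` [set r]).
    by rewrite -[X in measurable X]setTI; exact: measurable_funP.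
  pose v (i : nat) : R := (finmap.enum_fset (fset_set (an n @` setT)))`_i.
  have hi i : intble (fun w => \1_(an n @^-1` [set v i]) (X w) * f w).
    apply: (@intble_bounded_mul 1) => //.
      by apply: measurableT_comp => //; exact: measurable_indic.
    by move=> w; rewrite indicE; case: (_ \in _); rewrite ?normr1 ?normr0.
  have -> : (fun w => an n (X w) * f w) = (fun w =>
      \sum_(i < size (finmap.enum_fset (fset_set (an n @` setT))))
        (v i * (\1_(an n @^-1` [set v i]) (X w) * f w))).
    apply/funext => w; rewrite [in LHS]fimfunEord mulr_suml.
    by apply: eq_bigr => i _; rewrite mulrA.
  rewrite Ex_sum; last by move=> i; exact: intbleZ.
  by rewrite big1// => i _; rewrite ExZ// f0// mulr0.
have cv : (\int[P]_w (an n (X w) * f w)%:E)%E @[n --> \oo] -->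
    (\int[P]_w (a (X w) * f w)%:E)%E.
  have [|||||_ _ h] := @dominated_convergence _ _ _ P setT measurableT
      (fun n w => (an n (X w) * f w)%:E) (fun w => (a (X w) * f w)%:E)
      (fun w => `|a (X w) * f w|%:E).
  - by move=> n; exact: measurable_int (an_int n).
  - exact: measurable_int af.
  - apply: aeW => w _; rewrite EFinM; under eq_fun do rewrite EFinM.
    apply: cvgeM; [by rewrite mule_def_fin| |exact: cvg_cst].
    exact: (@cvg_nnsfun_approx _ _ _ _ measurableT _ mea ea0 (X w) I).
  - exact: integrable_norm.
  - by apply: aeW => w n _; rewrite /= lee_fin !normrM ler_wpM2r// !ger0_norm.
  - exact: h.
have cv0 : (\int[P]_w (an n (X w) * f w)%:E)%E @[n --> \oo] --> (0%R)%:E.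
  under eq_fun do rewrite ExE// an_Ex.
  exact: cvg_cst.
apply: EFin_inj; rewrite -ExE//; exact: cvg_unique cv cv0.
Qed.

End RealExpectation.

(** * Minimization of the averaged deterministic equivalent *)

Lemma qformE (R : realType) p (u v : 'cV[R]_p) (K : 'M[R]_p) :
  qform u K v = \sum_i \sum_j u i 0 * K i j * v j 0.
Proof.
rewrite /qform mxE exchange_big /=; apply: eq_bigr => j _.
by rewrite mxE mulr_suml; apply: eq_bigr => i _; rewrite !mxE.
Qed.

Section Signal.
Variables (R : realType) (d : measure_display) (T : measurableType d).
Variables (P : probability T R) (p : nat) (alpha : R) (beta : T -> 'cV[R]_p).
Hypothesis hs : isotropic_signal P alpha beta.

Lemma signal_sqint j : sqint P (fun t => beta t j 0).
Proof.
apply: sqint_fin; first exact: signal_measurable hs j.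
under eq_integral do rewrite expr2.
have := signal_second_moment hs j j; rewrite unlock => ->.
exact: ltry.
Qed.

Lemma Ex_signalM j k :
  Ex P (fun t => beta t j 0 * beta t k 0) = (alpha ^+ 2 / p%:R) *+ (j == k).
Proof.
have := signal_second_moment hs j k; rewrite unlock ExE ?mxE; last first.
  by apply: sqintM; exact: signal_sqint.
by move=> [].
Qed.

Lemma intble_signal_qform K : intble P (fun t => qform (beta t) K (beta t)).
Proof.
have h i j : intble P (fun t => K i j * (beta t i 0 * beta t j 0)).
  by apply/intbleZ/sqintM; exact: signal_sqint.
apply: eq_intble (intble_sum (fun i => intble_sum (h i))) => t.
by rewrite qformE; apply: eq_bigr => i _; apply: eq_bigr => j _; ring.
Qed.

Lemma Ex_signal_qform K :
  Ex P (fun t => qform (beta t) K (beta t)) = alpha ^+ 2 * ntr K.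
Proof.
have h i j : intble P (fun t => K i j * (beta t i 0 * beta t j 0)).
  by apply/intbleZ/sqintM; exact: signal_sqint.
have -> : (fun t => qform (beta t) K (beta t)) =
    (fun t => \sum_i \sum_j K i j * (beta t i 0 * beta t j 0)).
  apply/funext => t; rewrite qformE.
  by apply: eq_bigr => i _; apply: eq_bigr => j _; ring.
rewrite Ex_sum; last by move=> i; exact: intble_sum.
rewrite /ntr /mxtrace mulrCA mulr_suml; apply: eq_bigr => i _.
rewrite Ex_sum// (bigD1 i)//= big1 ?addr0 => [|j ji].
  by rewrite ExZ ?Ex_signalM ?eqxx ?mulr1n; [ring|apply: sqintM; exact: signal_sqint].
rewrite ExZ; last by apply: sqintM; exact: signal_sqint.
by rewrite Ex_signalM eq_sym (negbTE ji) mulr0n mulr0.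
Qed.

End Signal.

Lemma expected_equiv_risk (R : realType) (d : measure_display)
    (T : measurableType d) (P : probability T R) p (Sigma Sigma0 : 'M[R]_p)
    phi alpha sigma sigma0 (beta : T -> 'cV[R]_p) lambda :
  isotropic_signal P alpha beta ->
  let mu := mu_of Sigma phi lambda in let G := resolvent Sigma mu in
  let v := vtilde Sigma Sigma0 phi lambda in
  'E_P[(fun t => equiv_risk Sigma Sigma0 phi sigma sigma0 (beta t) (beta t)
                   lambda)]%E =
  (mu ^+ 2 * (alpha ^+ 2 * ntr (G *m (v *: Sigma + Sigma0) *m G)) +
   sigma ^+ 2 * v + sigma0 ^+ 2)%:E.
Proof.
move=> hs mu G v; rewrite unlock.
pose K := G *m (v *: Sigma + Sigma0) *m G; pose c := sigma ^+ 2 * v + sigma0 ^+ 2.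
have iK := intble_signal_qform hs K.
(* Since the test signal equals the training signal, this removes the shift term and the first term
   of kappa^2. *)
have q0 (u : 'cV[R]_p) L : qform u L 0 = 0 by rewrite /qform mulmx0 mxE.
have -> : (fun t => (equiv_risk Sigma Sigma0 phi sigma sigma0 (beta t) (beta t) lambda)%:E) =
    (fun t => (mu ^+ 2 * qform (beta t) K (beta t) + c)%:E).
  apply/funext => t; rewrite /equiv_risk /equiv_bias /equiv_var /equiv_shift /equiv_kappa2.
  by rewrite subrr !q0 mulr0 addr0 add0r -addrA.
rewrite ExE; last by apply: intbleD; [exact: intbleZ|exact: intble_cst].
rewrite ExD ?ExZ ?Ex_cst; [|exact: iK|exact: intbleZ|exact: intble_cst].
by rewrite (Ex_signal_qform hs) addrA.
Qed.

Section DeterministicRisk.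
Variables (R : realType) (p : nat) (Sigma Sigma0 : 'M[R]_p.+1).
Variables (phi alpha sigma sigma0 : R).
Hypotheses (pS : posdefmx Sigma) (pS0 : posdefmx Sigma0).
Hypotheses (phi0 : 0 < phi) (alpha0 : 0 < alpha) (sigma_gt0 : 0 < sigma).

Let risk lambda : R :=
  let mu := mu_of Sigma phi lambda in let G := resolvent Sigma mu in
  let v := vtilde Sigma Sigma0 phi lambda in
  mu ^+ 2 * (alpha ^+ 2 * ntr (G *m (v *: Sigma + Sigma0) *m G)) +
   sigma ^+ 2 * v + sigma0 ^+ 2.

Lemma argmin_deterministic_risk (g : R -> \bar R) :
  (forall l, g l = (risk l)%:E) ->
  argmin_on [set l : \bar R | ((lambda_min Sigma phi)%:E <= l)%E]
    (extend_to_endpoints (lambda_min Sigma phi) g) =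
  [set (phi / SNR alpha sigma)%:E].
Proof.
move=> gE; have [Q [s [QQ SE]]] := symmx_fcalc pS.1.
have s0 : forall i, 0 < s i by apply: (posdefmx_fcalc QQ); rewrite -SE.
pose c i := (Q *m Sigma0 *m Q^T) i i.
have c0 i : 0 < c i by apply: posdef_conj_diag => //; case: pS0.
pose i0 := [arg min_(i < ord0) s i]%O.
have smin_le i : s i0 <= s i by rewrite /i0; case: arg_minP => // j _ h; exact: h.
pose smin := s i0.
have smin_at : exists i, s i = smin by exists i0.
(* The eigenvalues are bounded below by 0 and include [smin], so the infimum is a genuine minimum
   and not a default value. *)
have eigmin : eigen_min Sigma = smin.
  apply/le_anti/andP; split.
    apply: ge_inf; first by exists 0 => a /=; rewrite SE => /eigenvalue_fcalcP -/(_ QQ)[i <-]; exact: ltW.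
    by rewrite /= SE; exact: eigenvalue_fcalc.
  apply: lb_le_inf; first by exists smin; rewrite /= SE; exact: eigenvalue_fcalc.
  by move=> a /=; rewrite SE => /eigenvalue_fcalcP -/(_ QQ)[i <-]; exact: smin_le.
have den m i : - smin < m -> s i + m != 0.
  move=> h; suff : 0 < s i + m by move/gt_eqF ->.
  by rewrite -(subrr smin) ler_ltD// ?smin_le.
have GE m : - smin < m -> resolvent Sigma m = fcalc Q (fun i => (s i + m)^-1).
  by move=> h; rewrite /resolvent SE (fcalc_scalar QQ m) fcalcD// fcalcV// => i; exact: den.
have ntrE C f : ntr (C *m fcalc Q f) = (\sum_i (Q *m C *m Q^T) i i * f i) / p.+1%:R.
  by rewrite /ntr trace_fcalc.
have ntr1E f : ntr (fcalc Q f) = (\sum_i f i) / p.+1%:R.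
  rewrite -[fcalc Q f]mul1mx ntrE mulmx1 QQ; congr (_ / _).
  by apply: eq_bigr => i _; rewrite mxE eqxx mul1r.
have edfE m : - smin < m ->
    phi * ntr (Sigma *m Sigma *m resolvent Sigma m *m resolvent Sigma m) = edf2 s phi m.
  move=> h; rewrite GE// SE !fcalcM// ntr1E /edf2; congr (_ * (_ / _)).
  by apply: eq_bigr => i _; field; exact: den.
have penE m : - smin < m ->
    m - phi * ntr (m *: (Sigma *m resolvent Sigma m)) = pen s phi m.
  by move=> h; rewrite GE// SE fcalcM// fcalcZ ntr1E.
have [mm [smm edfm]] : exists m, - smin < m /\ edf2 s phi m = 1.
  by have [m] := edf2_eq1 s0 phi0 smin_le smin_at; exists m.
(* A root exists, so [xget] returns a root and not its default 0; strict decrease of [edf2]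
   identifies it. *)
have mu_minE : mu_min Sigma phi = mm.
  have hm : [set mu : R | - eigen_min Sigma < mu /\
    1 = phi * ntr (Sigma *m Sigma *m resolvent Sigma mu *m resolvent Sigma mu)] mm.
    by rewrite /= eigmin edfE.
  have [] := xgetPex 0 (ex_intro _ _ hm); rewrite -/(mu_min Sigma phi) eigmin => h.
  rewrite edfE// -edfm => e.
  have [/(edf2_decr s0 phi0 smin_le h)|/(edf2_decr s0 phi0 smin_le smm)|//] := ltgtP (mu_min Sigma phi) mm;
  by rewrite e ltxx.
have lminE : lambda_min Sigma phi = pen s phi mm.
  by rewrite /lambda_min mu_minE penE.
(* Surjectivity of [pen] rules out the default value here too: [mu_of] is a right inverse of [pen]
   above lambda_min. *)
have muP l : lambda_min Sigma phi < l ->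
    mm < mu_of Sigma phi l /\ pen s phi (mu_of Sigma phi l) = l.
  rewrite lminE => /(pen_surj s0 phi0 smin_le smm)[m mmm pm].
  have hm : [set mu : R | mu_min Sigma phi < mu /\
    mu = l + phi * ntr (mu *: (Sigma *m resolvent Sigma mu))] m.
    by rewrite /= mu_minE -pm -penE ?subrK//; exact: lt_trans mmm.
  have [] := xgetPex 0 (ex_intro _ _ hm); rewrite -/(mu_of Sigma phi l) mu_minE => h e.
  split=> //; rewrite -penE; last exact: lt_trans h.
  by rewrite {1}e addrK.
set ls := phi / SNR alpha sigma.
have ls0 : 0 < ls by rewrite divr_gt0// /SNR divr_gt0// exprn_gt0.
have lminls : lambda_min Sigma phi < ls.
  by rewrite lminE (le_lt_trans _ ls0)// (pen_m0_le0 s0 phi0 smin_le smin_at smm edfm).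
have [ms0 pms] := muP _ lminls.
set ms := mu_of Sigma phi ls in ms0 pms.
have riskE l : lambda_min Sigma phi < l ->
    risk l = sigma0 ^+ 2 + alpha ^+ 2 * tangent s c phi ms (mu_of Sigma phi l).
  move=> /muP[]; rewrite /risk /vtilde; set m := mu_of _ _ _ => hm pm.
  have sm := lt_trans smm hm.
  have D0 : 1 - edf2 s phi m != 0.
    by rewrite gt_eqF// subr_gt0 (edf2_lt1 s0 phi0 smin_le smm edfm).
  rewrite edfE//.
  have -> : ntr (Sigma0 *m Sigma *m resolvent Sigma m *m resolvent Sigma m) = eff' s c m.
    rewrite GE// SE -mulmxA -mulmxA !fcalcM// ntrE /eff'; congr (_ / _).
    by apply: eq_bigr => i _; rewrite -/(c i); field; exact: den.
  set v := _ / _.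
  pose Ss := (\sum_i s i / (s i + m) ^+ 2) / p.+1%:R.
  pose Sc := (\sum_i c i / (s i + m) ^+ 2) / p.+1%:R.
  have -> : ntr (resolvent Sigma m *m (v *: Sigma + Sigma0) *m resolvent Sigma m) =
      v * Ss + Sc.
    rewrite -mulmxA /ntr mxtrace_mulC -mulmxA GE// fcalcM// mulmxDl mxtraceD.
    rewrite -scalemxAl mxtraceZ mulrDl -mulrA -!/(ntr _) (ntrE Sigma0) {1}SE fcalcM// ntr1E.
    congr (_ * (_ / _) + _ / _); apply: eq_bigr => i _; last rewrite -/(c i).
      by field; exact: den.
    by field; exact: den.
  (* Both this identity and [SsE] come from s + m over (s + m)^2. They turn the bias into alpha^2 *
     (eff - pen * slope), and the variance sigma^2 * phi * slope supplies the missing alpha^2 * ls *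
     slope. *)
  have effE : eff s c m = m ^+ 2 * Sc + m * eff' s c m.
    rewrite /eff /Sc /eff' !mulrA -mulrDl !mulr_sumr -big_split /=; congr (_ / _).
    by apply: eq_bigr => i _; field; exact: den.
  have SsE : phi * m ^+ 2 * Ss = m * (1 - edf2 s phi m) - pen s phi m.
    rewrite /Ss /edf2 /pen.
    have -> : \sum_i m * (s i / (s i + m)) =
        m ^+ 2 * (\sum_i s i / (s i + m) ^+ 2) + m * (\sum_i s i ^+ 2 / (s i + m) ^+ 2).
      by rewrite !mulr_sumr -big_split /=; apply: eq_bigr => i _; field; exact: den.
    by field; rewrite nat1r pnatr_eq0.
  rewrite /tangent /slope effE pms.
  have vE : v = phi * eff' s c m / (1 - edf2 s phi m) by [].
  have mE : m ^+ 2 * v * Ss = eff' s c m * m - eff' s c m * pen s phi m / (1 - edf2 s phi m).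
    have -> : m ^+ 2 * v * Ss = eff' s c m / (1 - edf2 s phi m) * (phi * m ^+ 2 * Ss).
      by rewrite vE; ring.
    by rewrite SsE; field.
  have -> : m ^+ 2 * (alpha ^+ 2 * (v * Ss + Sc)) =
      alpha ^+ 2 * (m ^+ 2 * v * Ss) + alpha ^+ 2 * m ^+ 2 * Sc by ring.
  rewrite mE vE /ls /SNR; field.
  by rewrite D0 !gt_eqF.
(* [mu_of] inverts the increasing function [pen], so monotonicity in mu carries over to lambda. *)
have mu_mono l1 l2 : lambda_min Sigma phi < l1 -> l1 < l2 ->
    mu_of Sigma phi l1 < mu_of Sigma phi l2.
  move=> h1 h12; have h2 := lt_trans h1 h12.
  have [m1 p1] := muP _ h1; have [m2 p2] := muP _ h2.
  rewrite ltNge le_eqVlt; apply/negP => /predU1P[e|].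
    by move: h12; rewrite -p1 -p2 e ltxx.
  move/(pen_incr s0 phi0 smin_le smm edfm (ltW m2)); rewrite p1 p2 => /(lt_trans h12).
  by rewrite ltxx.
apply: (argmin_unimodal (f := risk)) => // l1 l2.
- move=> h1 h12 h2; have h := lt_trans h1 h12.
  rewrite !riskE// ltrD2l ltr_pM2l ?exprn_gt0//.
  apply: (tangent_decr s0 c0 phi0 smin_le smm edfm) => //.
  + by case: (muP _ h1).
  + exact: mu_mono.
  + by move: h2; rewrite le_eqVlt => /predU1P[->//|/(mu_mono _ _ h)/ltW].
- move=> h1 h12; have h := lt_le_trans lminls h1; have h' := lt_trans h h12.
  rewrite !riskE// ltrD2l ltr_pM2l ?exprn_gt0//.
  apply: (tangent_incr s0 c0 phi0 smin_le smm edfm) => //.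
  + by move: h1; rewrite le_eqVlt => /predU1P[<-|/(mu_mono _ _ lminls)/ltW]//; exact: lexx.
  + exact: mu_mono.
Qed.

End DeterministicRisk.

(** * Independence *)

Section Independence.
Variables (R : realType) (d : measure_display) (T : measurableType d).
Variable P : probability T R.
Variables (d' : measure_display) (U : measurableType d').
Variables (I : finType) (X : I -> T -> U).
Hypotheses (mX : forall i, measurable_fun [set: T] (X i)).
Hypothesis (hX : mutually_independent P X).

Definition other_events (i : I) (C : I -> set U) : set T :=
  \bigcap_(k in [set k | k != i]) (X k @^-1` C k).

Lemma measurable_preimT (i : I) A : measurable A -> measurable (X i @^-1` A).
Proof. by move=> mA; rewrite -[X in measurable X]setTI; exact: mX. Qed.

Lemma measurable_other_events i C : (forall k, measurable (C k)) ->
  measurable (other_events i C).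
Proof.
move=> mC; apply: fin_bigcap_measurable => [|k _]; first exact: finite_finset.
exact: measurable_preimT.
Qed.

Let bigcapD1 i (C : I -> set U) :
  \bigcap_(k in [set: I]) (X k @^-1` C k) = X i @^-1` C i `&` other_events i C.
Proof.
apply/seteqP; split => [w h|w [hi h] k _].
  by split; [exact: h|move=> k _; exact: h].
by have [->//|ki] := eqVneq k i; exact: h.
Qed.

(** The product rule is used twice, with [A] and with the full space in place [i]; the remaining
    factors agree. *)
Lemma indep_event i A C : measurable A -> (forall k, measurable (C k)) ->
  Ex P (fun w => \1_A (X i w) * \1_(other_events i C) w) =
  Ex P (fun w => \1_A (X i w)) * Ex P (\1_(other_events i C)).
Proof.
move=> mA mC; pose C1 k := if k == i then A else C k.
pose C2 k := if k == i then setT else C k.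
have mC1 k : measurable (C1 k) by rewrite /C1; case: ifP.
have mC2 k : measurable (C2 k) by rewrite /C2; case: ifP.
have E1 : other_events i C1 = other_events i C.
  by apply: eq_bigcapr => k /= ki; rewrite /C1 (negbTE ki).
have E2 : other_events i C2 = other_events i C.
  by apply: eq_bigcapr => k /= ki; rewrite /C2 (negbTE ki).
have mE := measurable_other_events i mC.
have mXA := measurable_preimT i mA.
have := hX mC2; have := hX mC1; rewrite !(bigcapD1 i) E1 E2.
rewrite [C1 i]/C1 [C2 i]/C2 eqxx preimage_setT setTI.
rewrite (bigD1 i)//= [in X in _ -> X](bigD1 i)//= [C1 i]/C1 [C2 i]/C2 eqxx.
rewrite preimage_setT probability_setT mul1e.
have -> : (\prod_(k | k != i) P (X k @^-1` C1 k))%E = (\prod_(k | k != i) P (X k @^-1` C2 k))%E.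
  by apply: eq_bigr => k ki; rewrite /C1 /C2 (negbTE ki).
move=> h e; rewrite -e in h.
rewrite (_ : (fun w => _ * _) = \1_(X i @^-1` A `&` other_events i C)); last first.
  by apply/funext => w; rewrite indicI.
rewrite !Ex_indic//; last exact: measurableI.
by rewrite h fineM// fin_num_measure.
Qed.

(** Independence is recast as orthogonality: the centred indicator of the other events has
    conditional mean zero given [X i], so it is orthogonal to the possibly unbounded [a (X i)]. *)
Lemma indep_Ex i (a : U -> R) C : measurable_fun [set: U] a ->
  intble P (fun w => a (X i w)) -> (forall k, measurable (C k)) ->
  Ex P (fun w => a (X i w) * \1_(other_events i C) w) =
  Ex P (fun w => a (X i w)) * Ex P (\1_(other_events i C)).
Proof.
move=> ma ia mC; set E := other_events i C; set q := Ex P \1_E.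
have mE : measurable E := measurable_other_events i mC.
have i1 : intble P (\1_E : T -> R).
  by apply: eq_intble (intble_indic mE (intble_cst P 1)) => w; rewrite mulr1.
have ia1 : intble P (fun w => a (X i w) * \1_E w).
  by apply: eq_intble (intble_indic mE ia) => w; rewrite mulrC.
have iaq : intble P (fun w => a (X i w) * q).
  by apply: eq_intble (intbleZ q ia) => w; rewrite mulrC.
have : Ex P (fun w => a (X i w) * (\1_E w - q)) = 0.
  apply: (@Ex_orthogonal _ _ _ P _ _ (X i)) => //.
  - by apply: intbleB => //; exact: intble_cst.
  - move=> B mB; have mXB := measurable_preimT i mB.
    have iB : intble P (fun w => \1_B (X i w)).
      by apply: eq_intble (intble_indic mXB (intble_cst P 1)) => w; rewrite mulr1.
    have iBE : intble P (fun w => \1_B (X i w) * \1_E w).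
      exact: (intble_indic mXB).
    have -> : (fun w => \1_B (X i w) * (\1_E w - q)) =
        (fun w => \1_B (X i w) * \1_E w - q * \1_B (X i w)).
      by apply/funext => w; rewrite mulrBr [q * _]mulrC.
    rewrite ExB//; last exact: intbleZ.
    by rewrite indep_event// ExZ// mulrC subrr.
  - by apply: eq_intble (intbleB ia1 iaq) => w; rewrite mulrBr.
have -> : (fun w => a (X i w) * (\1_E w - q)) =
    (fun w => a (X i w) * \1_E w - q * a (X i w)).
  by apply/funext => w; rewrite mulrBr [q * _]mulrC.
rewrite ExB//; last exact: intbleZ.
by rewrite ExZ// => /eqP; rewrite subr_eq0 => /eqP ->; rewrite mulrC.
Qed.

End Independence.

(** * Rectangles of designs as a generating pi-system *)

Section TupleMeasurability.
Variables (d : measure_display) (U : measurableType d) (n : nat).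

Definition tuple_rect (C : 'I_n -> set U) : set (n.-tuple U) :=
  \bigcap_(i in [set: 'I_n]) ((fun u => tnth u i) @^-1` C i).

Lemma measurable_tuple_rect C : (forall i, measurable (C i)) ->
  measurable (tuple_rect C).
Proof.
move=> mC; apply: fin_bigcap_measurable => [|i _]; first exact: finite_finset.
by rewrite -[X in measurable X]setTI; exact: measurable_tnth.
Qed.

Definition tuple_rects : set (set (n.-tuple U)) :=
  [set B | exists2 C, (forall i, measurable (C i)) & B = tuple_rect C].

Lemma measurable_tuple_rects : @measurable _ (n.-tuple U) = <<s tuple_rects >>.
Proof.
rewrite eqEsubset; split => A.
- apply: smallest_sub; first exact: smallest_sigma_algebra.
  rewrite -bigcup_seq /= => B [i _ [D mD <-]]; apply: sub_gen_smallest.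
  exists (fun k => if k == i then D else setT).
    by move=> k; case: ifP.
  rewrite setTI; apply/seteqP; split => [u Du k _ /=|u h].
    by case: eqVneq => [->|].
  by have := h i I; rewrite /= eqxx.
- apply: smallest_sub; first exact: sigma_algebra_measurable.
  by move=> B [C mC ->]; exact: measurable_tuple_rect.
Qed.

Lemma setI_closed_tuple_rects : setI_closed tuple_rects.
Proof.
move=> _ _ [C mC ->] [D mD ->]; exists (fun i => C i `&` D i).
  by move=> i; exact: measurableI.
by rewrite /tuple_rect -bigcapI.
Qed.

End TupleMeasurability.

(** Dynkin's argument: the events with vanishing integral of [f] form a lambda-system. The rectangle
    with full sides gives total integral zero, hence complements; integrability of [f] gives
    countable disjoint unions. *)
Lemma Ex_tuple_ortho (R : realType) (d d' : measure_display)
    (T : measurableType d) (P : probability T R) (U : measurableType d') n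
    (X : T -> n.-tuple U) (f : T -> R) :
  measurable_fun [set: T] X -> intble P f ->
  (forall C, (forall i, measurable (C i)) ->
    Ex P (fun w => \1_(tuple_rect C) (X w) * f w) = 0) ->
  forall B, measurable B -> Ex P (fun w => \1_B (X w) * f w) = 0.
Proof.
move=> mX hf h B; rewrite measurable_tuple_rects.
have mpre A : measurable A -> measurable (X @^-1` A).
  by move=> mA; rewrite -[X in measurable X]setTI; exact: mX.
have iA A : measurable A -> intble P (fun w => \1_A (X w) * f w).
  by move=> /mpre mA; exact: (intble_indic mA).
move: B; apply: (@dynkin_induction _ _ (@tuple_rects _ U n)
  (fun B => Ex P (fun w => \1_B (X w) * f w) = 0)).
- exact: measurable_tuple_rects.
- exact: setI_closed_tuple_rects.
- rewrite (_ : setT = tuple_rect (fun=> setT)); first exact: h.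
  by apply/seteqP; split.
- by move=> _ [C mC ->]; exact: h.
- move=> S mS hS.
  have -> : (fun w => \1_(~` S) (X w) * f w) = (fun w => f w - \1_S (X w) * f w).
    apply/funext => w; rewrite !indicE in_setC; case: (_ \in _) => /=.
      by rewrite mul0r mul1r subrr.
    by rewrite mul1r mul0r subr0.
  rewrite ExB ?hS ?subr0//; last exact: iA.
  have := h (fun=> setT) (fun=> measurableT); rewrite (_ : tuple_rect _ = setT).
    move=> e; rewrite -[RHS]e; apply: eq_Ex => w.
    by rewrite indicE mem_set// mul1r.
  by apply/seteqP; split.
- move=> F mF tF hF; apply: EFin_inj.
  have e A : measurable A ->
      (Ex P (fun w => \1_A (X w) * f w))%:E = (\int[P]_(w in X @^-1` A) (f w)%:E)%E.
    by move=> mA; rewrite (integral_in_Ex (mpre _ mA) hf).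
  rewrite e; last exact: bigcupT_measurable.
  rewrite preimage_bigcup integral_bigcup.
  + by apply: eseries0 => i _ _; rewrite -e// hF.
  + move=> i j _ _ [w [Fi Fj]]; apply: tF => //.
    by exists (X w).
  + by move=> k; exact: mpre.
  + apply: (integrableS measurableT) => //.
    by apply: bigcupT_measurable => k; exact: mpre.
Qed.

(** * Moments of an observation *)

Lemma tnth_tuple_of_col (R : realType) p (v : 'cV[R]_p) j :
  tnth (tuple_of_col v) j = v j 0.
Proof. by rewrite tnth_mktuple. Qed.

(** The noise as a function of the observation (x, y), so that independence of observations applies
    to it directly. *)
Definition residual (R : realType) p (b : 'cV[R]_p) (u : p.-tuple R * R) : R :=
  u.2 - \sum_j tnth u.1 j * b j 0.

Lemma measurable_residual (R : realType) p (b : 'cV[R]_p) :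
  measurable_fun [set: p.-tuple R * R] (residual b).
Proof.
apply: measurable_funB; first exact: measurable_snd.
apply: measurable_sum => j; apply: measurable_funM => //.
exact: (measurableT_comp (measurable_tnth j)).
Qed.

Section Population.
Variables (R : realType) (d : measure_display) (T : measurableType d).
Variables (P : probability T R) (p : nat) (Sigma : 'M[R]_p) (sigma : R).
Variables (z : 'I_p -> {RV P >-> R}) (y : 'cV[R]_p -> {RV P >-> R}).
Hypothesis pop : population Sigma sigma z y.

Lemma population_posdef : posdefmx Sigma.
Proof. by apply: posdefmx_eigen; [exact: pop_sym pop|exact: pop_eigen pop]. Qed.

Let x := feature Sigma z.

Lemma measurable_RV (X : {RV P >-> R}) : measurable_fun [set: T] X.
Proof. exact: measurable_funPT. Qed.

Lemma sqint_z j : sqint P (z j) /\ Ex P (fun w => z j w ^+ 2) = 1.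
Proof.
have V1 : (\int[P]_w (z j w ^+ 2)%:E = 1)%E.
  have := pop_z_var pop j; rewrite /variance covariance.unlock (pop_z_mean pop j) expectation.unlock => <-.
  by apply: eq_integral => w _; rewrite !fctE /= subr0 expr2.
have sz : sqint P (z j).
  by apply: sqint_fin; [exact: measurable_RV|rewrite V1 ltry].
by split => //; apply: EFin_inj; rewrite -ExE ?V1//; case: sz.
Qed.

Lemma Ex_z j : Ex P (z j) = 0.
Proof.
apply: EFin_inj; rewrite -ExE; last exact: sqint_intble (sqint_z j).1.
by have := pop_z_mean pop j; rewrite unlock.
Qed.

Lemma Ex_zz j k : Ex P (fun w => z j w * z k w) = (j == k)%:R.
Proof.
have [->|jk] := eqVneq j k; first exact: (sqint_z k).2.
have ij := sqint_intble (sqint_z j).1.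
rewrite (_ : (fun w => _) = fun w => z k w * z j w); last by apply/funext => w; rewrite mulrC.
apply: (@Ex_orthogonal _ _ _ P _ _ (z k) id); [exact: measurable_RV|exact: measurable_id|by []| |].
  (* With full sides except in place [k], the event on the coordinates other than [j] is just z_k in
     B, because k differs from j. *)
  move=> B mB; pose C (l : 'I_p) : set R := if l == k then B else setT.
  have mC l : measurable (C l) by rewrite /C; case: ifP.
  have mz l : measurable_fun [set: T] (z l : T -> R) by exact: measurable_RV.
  have := indep_Ex mz (pop_z_indep pop) (@measurable_id _ _ setT) ij mC.
  rewrite Ex_z mul0r => e; rewrite -[RHS]e; apply: eq_Ex => w.
  rewrite mulrC; congr (_ * _); rewrite !indicE; congr ((nat_of_bool _)%:R).
  apply/idP/idP; rewrite !inE.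
    by move=> Bw l /= _; rewrite /C; case: eqVneq => [->|].
  by move=> /(_ k); rewrite /= /C eqxx eq_sym; apply.
by apply: sqintM; [case: (sqint_z k)|case: (sqint_z j)].
Qed.

Lemma featureE w j : x w j 0 = \sum_k sqrtmx Sigma j k * z k w.
Proof. by rewrite /x /feature mxE; apply: eq_bigr => k _; rewrite mxE. Qed.

Lemma sqint_feature j : sqint P (fun w => x w j 0).
Proof.
under eq_fun do rewrite featureE.
by apply: sqint_sum => k; apply: sqintZ; case: (sqint_z k).
Qed.

Lemma Ex_feature j k : Ex P (fun w => x w j 0 * x w k 0) = Sigma j k.
Proof.
have [[sS _] SS] := sqrtmxP population_posdef.
set S := sqrtmx Sigma in sS SS.
have iz a b : intble P (fun w => z a w * z b w).
  by apply: sqintM; [case: (sqint_z a)|case: (sqint_z b)].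
have -> : (fun w => x w j 0 * x w k 0) =
    (fun w => \sum_a \sum_b (S j a * S k b) * (z a w * z b w)).
  apply/funext => w; rewrite !featureE mulr_suml; apply: eq_bigr => a _.
  by rewrite mulr_sumr; apply: eq_bigr => b _; rewrite /S; ring.
rewrite Ex_sum => [|a]; last by apply: intble_sum => b; exact: intbleZ.
rewrite -SS mxE; apply: eq_bigr => a _.
rewrite Ex_sum => [|b]; last exact: intbleZ.
rewrite (bigD1 a)//= big1 ?addr0 => [|b ba].
  rewrite ExZ// Ex_zz eqxx mulr1; congr (_ * _).
  by rewrite -[in LHS]sS mxE.
by rewrite ExZ// Ex_zz eq_sym (negbTE ba) mulr0.
Qed.

Lemma linear_predictorE (b : 'cV[R]_p) w : ((x w)^T *m b) 0 0 = \sum_j x w j 0 * b j 0.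
Proof. by rewrite mxE; apply: eq_bigr => j _; rewrite mxE. Qed.

Lemma sqint_predictor (b : 'cV[R]_p) : sqint P (fun w => ((x w)^T *m b) 0 0).
Proof.
under eq_fun do rewrite linear_predictorE.
apply: sqint_sum => j; under eq_fun do rewrite mulrC.
by apply: sqintZ; exact: sqint_feature.
Qed.

Let noise b w := y b w - ((x w)^T *m b) 0 0.

Lemma sqint_noise b : sqint P (noise b) /\ Ex P (fun w => noise b w ^+ 2) = sigma ^+ 2.
Proof.
have := pop_noise_var pop b; rewrite unlock => e.
have sn : sqint P (noise b).
  apply: sqint_fin; last by rewrite e ltry.
  apply: measurable_funB; first exact: measurable_RV.
  by case: (sqint_predictor b).
by split => //; apply: EFin_inj; rewrite -ExE ?e//; case: sn.
Qed.

Lemma sqint_response b : sqint P (y b).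
Proof.
have := sqintD (sqint_noise b).1 (sqint_predictor b).
by under eq_fun do rewrite subrK.
Qed.

(** Normal equations: as E[x x^T] = Sigma is invertible, the projection parameter satisfies Sigma b
    = E[x y]. *)
Lemma Ex_feature_noise b j : Ex P (fun w => x w j 0 * noise b w) = 0.
Proof.
have sx := sqint_feature; have sy := sqint_response b.
have ix k : intble P (fun w => x w j 0 * x w k 0) by exact: sqintM.
have -> : (fun w => x w j 0 * noise b w) =
   (fun w => x w j 0 * y b w - \sum_k b k 0 * (x w j 0 * x w k 0)).
  apply/funext => w; rewrite /noise linear_predictorE mulrBr mulr_sumr.
  by congr (_ - _); apply: eq_bigr => k _; ring.
have ixb k : intble P (fun w => b k 0 * (x w j 0 * x w k 0)) by exact: intbleZ.
rewrite ExB; [|exact: sqintM|exact: intble_sum].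
rewrite Ex_sum//; under eq_bigr do rewrite ExZ// Ex_feature.
have := pop_projection pop b; cbv zeta; rewrite -/x.
have -> : \matrix_(j0, k) fine 'E_P[(fun w : T => x w j0 0 * x w k 0)] = Sigma.
  apply/matrixP => a c; rewrite mxE unlock ExE ?Ex_feature//.
  exact: sqintM.
move=> /(congr1 (mulmx Sigma)); rewrite mulKVmx; last exact: posdefmx_unit population_posdef.
move=> /colP/(_ j); rewrite !mxE expectation.unlock ExE /=; last exact: sqintM.
by move=> <-; apply/eqP; rewrite subr_eq0; apply/eqP/eq_bigr => k _; rewrite mulrC.
Qed.

(** Expanding the square around [b], the cross term vanishes because the noise is uncorrelated with
    every linear function of x. *)
Lemma ood_riskE b bhat :
  ood_risk Sigma z y b bhat = (qform (bhat - b) Sigma (bhat - b) + sigma ^+ 2)%:E.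
Proof.
rewrite /ood_risk unlock; set u := bhat - b.
have [sn nv] := sqint_noise b.
have iq i j : intble P (fun w => u i 0 * u j 0 * (x w i 0 * x w j 0)).
  by apply/intbleZ/sqintM; exact: sqint_feature.
have ixn j : intble P (fun w => - 2 * u j 0 * (x w j 0 * noise b w)).
  by apply/intbleZ/sqintM => //; exact: sqint_feature.
have i1 := intble_sum (fun i => intble_sum (iq i)).
have i2 := intble_sum ixn.
have -> : (fun w => ((((feature Sigma z w)^T *m bhat) 0 0 - y b w) ^+ 2)%:E) =
  (fun w => ((\sum_i \sum_j u i 0 * u j 0 * (x w i 0 * x w j 0) +
    \sum_j - 2 * u j 0 * (x w j 0 * noise b w)) + noise b w ^+ 2)%:E).
  apply/funext => w; congr (_%:E); rewrite -/(x w).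
  have -> : ((x w)^T *m bhat) 0 0 - y b w = ((x w)^T *m u) 0 0 - noise b w.
    rewrite /noise /u mulmxBr [X in _ = X - _]mxE [X in _ = _ + X - _]mxE.
    by ring.
  rewrite sqrrB; congr (_ + _).
  have -> : \sum_i \sum_j u i 0 * u j 0 * (x w i 0 * x w j 0) = ((x w)^T *m u) 0 0 ^+ 2.
    rewrite expr2 linear_predictorE mulr_suml; apply: eq_bigr => i _.
    by rewrite mulr_sumr; apply: eq_bigr => j _; ring.
  congr (_ + _); rewrite linear_predictorE mulr_suml -mulr_natl mulr_sumr -sumrN.
  by apply: eq_bigr => j _; ring.
rewrite ExE; last by apply: intbleD; [exact: intbleD|case: sn].
congr (_%:E); rewrite ExD; [|exact: intbleD|by case: sn].
rewrite nv ExD//; congr (_ + _).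
rewrite (Ex_sum ixn) [X in _ + X]big1 ?addr0 => [|j _]; last first.
  rewrite ExZ ?Ex_feature_noise ?mulr0//.
  by apply/sqintM => //; exact: sqint_feature.
rewrite qformE Ex_sum => [|i]; last exact: intble_sum.
apply: eq_bigr => i _; rewrite Ex_sum//; apply: eq_bigr => j _.
rewrite ExZ ?Ex_feature; first by ring.
by apply: sqintM; exact: sqint_feature.
Qed.

Let X w := tuple_of_col (x w).

Lemma measurable_feature_tuple : measurable_fun [set: T] X.
Proof.
apply/measurable_fun_tnthP => j.
rewrite (_ : _ \o _ = fun w => x w j 0); first by case: (sqint_feature j).
by apply/funext => w; rewrite /= tnth_tuple_of_col.
Qed.

Lemma residualE b w : residual b (X w, y b w) = noise b w.
Proof.
by rewrite /residual /noise linear_predictorE; under eq_bigr do rewrite tnth_tuple_of_col.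
Qed.

(* [pop_noise_var] and [pop_cond_var] together force E[y | x] = x^T b a.s. *)
Lemma noise_cond_moments b B : measurable B ->
  Ex P (fun w => \1_B (X w) * noise b w) = 0 /\
  Ex P (fun w => \1_B (X w) * noise b w ^+ 2) = sigma ^+ 2 * Ex P (fun w => \1_B (X w)).
Proof.
have mX := measurable_feature_tuple.
have mpre A : measurable A -> measurable (X @^-1` A).
  by move=> mA; rewrite -[X in measurable X]setTI; exact: mX.
have [sn nv] := sqint_noise b; have sy := sqint_response b.
have [m [mm hm] [_ hv]] := pop_cond_var pop b.
move/measurable_EFinP in mm.
pose r w := y b w - m (X w).
have mmX : measurable_fun [set: T] (fun w => m (X w)) by exact: measurableT_comp.
have v1 A : measurable A -> (\int[P]_(w in X @^-1` A) (r w ^+ 2)%:E = (sigma ^+ 2)%:E * P (X @^-1` A))%E.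
  by move=> mA; rewrite /r hv// integral_cst//; exact: mpre.
have v1T : (\int[P]_w (r w ^+ 2)%:E = (sigma ^+ 2)%:E)%E.
  by have := v1 _ measurableT; rewrite preimage_setT [X in (_ * X)%E]probability_setT mule1.
have sr : sqint P r.
  apply: sqint_fin; last by rewrite v1T ltry.
  by apply: measurable_funB => //; exact: measurable_RV.
have rv : Ex P (fun w => r w ^+ 2) = sigma ^+ 2.
  by apply: EFin_inj; rewrite -ExE ?v1T//; case: sr.
(* The conditional variance makes [r] square integrable, and m(X) = y - r inherits this from [y]. *)
have smX : sqint P (fun w => m (X w)).
  have := sqintB sy sr; rewrite (_ : (fun w => _) = (fun w => m (X w)))//.
  by apply/funext => w; rewrite /r opprB addrC subrK.
have r0 A : measurable A -> Ex P (fun w => \1_A (X w) * r w) = 0.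
  move=> mA; have := hm _ mA.
  rewrite (integral_in_Ex (mpre _ mA) (sqint_intble sy)).
  rewrite (integral_in_Ex (mpre _ mA) (sqint_intble smX)) => -[e].
  have -> : (fun w => \1_A (X w) * r w) = (fun w => \1_(X @^-1` A) w * y b w - \1_(X @^-1` A) w * m (X w)).
    by apply/funext => w; rewrite mulrBr.
  rewrite ExB ?e ?subrr//; apply: intble_indic; [exact: mpre|exact: sqint_intble|exact: mpre|exact: sqint_intble].
pose a (u : p.-tuple R) := m u - \sum_j tnth u j * b j 0.
have ma : measurable_fun [set: p.-tuple R] a.
  apply: measurable_funB => //; apply: measurable_sum => j.
  by apply: measurable_funM => //; exact: measurable_tnth.
have aE w : a (X w) = m (X w) - ((x w)^T *m b) 0 0.
  by rewrite /a linear_predictorE; under eq_bigr do rewrite tnth_tuple_of_col.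
have sa : sqint P (fun w => a (X w)).
  under eq_fun do rewrite aE.
  by apply: sqintB => //; exact: sqint_predictor.
have nE w : noise b w = r w + a (X w) by rewrite aE /noise /r; ring.
have ar0 : Ex P (fun w => a (X w) * r w) = 0.
  by apply: Ex_orthogonal => //; [exact: sqint_intble|exact: sqintM].
(* Pythagoras: E[noise^2] = E[r^2] + E[a(X)^2], and both variances equal sigma^2. *)
have a2 : Ex P (fun w => a (X w) ^+ 2) = 0.
  have := nv; under eq_Ex do rewrite nE.
  have -> : (fun w => (r w + a (X w)) ^+ 2) = (fun w => r w ^+ 2 + (2 * (a (X w) * r w) + a (X w) ^+ 2)).
    by apply/funext => w; ring.
  have iar := intbleZ 2 (sqintM sa sr).
  rewrite ExD; [|by case: sr|by apply: intbleD => //; case: sa].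
  rewrite ExD//; last by case: sa.
  rewrite ExZ; last exact: sqintM.
  by rewrite rv ar0 mulr0 add0r => /eqP; rewrite -subr_eq0 addrC addKr => /eqP.
have a0 : {ae P, forall w, a (X w) = 0}.
  have : (\int[P]_w `|(a (X w) ^+ 2)%:E| = 0)%E.
    under eq_integral do rewrite gee0_abs ?lee_fin ?sqr_ge0//.
    by rewrite ExE ?a2//; case: sa.
  have mea : measurable_fun [set: T] (fun w => (a (X w) ^+ 2)%:E).
    by apply/measurable_EFinP/measurable_funX; case: sa.
  move=> /(ae_eq_integral_abs _ measurableT mea) [N [mN N0 hN]].
  exists N; split => // w /= h; apply: hN => /= h'; apply: h.
  by have /eqP := h' I; rewrite eqe sqrf_eq0 => /eqP.
have aeEx (f g : T -> R) : intble P f -> intble P g -> {ae P, forall w, f w = g w} -> Ex P f = Ex P g.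
  move=> hf hg fg; apply: EFin_inj; rewrite -!ExE//; apply: ae_eq_integral => //.
  - exact: measurable_int hf.
  - exact: measurable_int hg.
  - by apply: filterS fg => w -> _.
move=> mB; have iB f : intble P f -> intble P (fun w => \1_B (X w) * f w).
  by move=> hf; exact: (intble_indic (mpre _ mB)).
split.
  rewrite -(r0 _ mB); apply: aeEx.
  - by apply: iB; exact: sqint_intble.
  - by apply: iB; exact: sqint_intble.
  - by apply: filterS a0 => w h; rewrite nE h addr0.
rewrite (aeEx _ (fun w => \1_B (X w) * r w ^+ 2)).
- apply: EFin_inj; have := v1 _ mB.
  rewrite (integral_in_Ex (mpre _ mB)); last by case: sr.
  move=> ->; rewrite [RHS]EFinM; congr (_ * _)%E.
  by rewrite (Ex_indic _ (mpre _ mB)) fineK// fin_num_measure//; exact: mpre.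
- by apply: iB; case: sn.
- by apply: iB; case: sr.
- by apply: filterS a0 => w h; rewrite nE h addr0.
Qed.

End Population.

(** * Conditional moments of the training noise *)

Lemma indicM (R : pzRingType) (T : Type) (A B : set T) (w : T) :
  \1_A w * \1_B w = \1_(A `&` B) w :> R.
Proof. by rewrite indicI. Qed.

Section Train.
Variables (R : realType) (d : measure_display) (T : measurableType d).
Variables (P : probability T R) (n p : nat) (Sigma : 'M[R]_p) (sigma : R).
Variables (z : 'I_n -> 'I_p -> {RV P >-> R}).
Variables (y : 'cV[R]_p -> 'I_n -> {RV P >-> R}).
Hypothesis train : train_sample Sigma sigma z y.

Let x i w := tuple_of_col (feature Sigma (z i) w).
Let X w := tuple_of_rows (train_features Sigma z w).
Variable b : 'cV[R]_p.
Let Z i w : p.-tuple R * R := (x i w, y b i w).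

Definition train_noise i w := y b i w - ((feature Sigma (z i) w)^T *m b) 0 0.
Let eps := train_noise.

Let pop i : population Sigma sigma (z i) (fun b => y b i) := train_pop train i.

Lemma tnth_train_features i w : tnth (X w) i = x i w.
Proof.
rewrite tnth_mktuple /x; congr tuple_of_col.
by apply/colP => j; rewrite !mxE.
Qed.

Lemma measurable_train_features : measurable_fun [set: T] X.
Proof.
apply/measurable_fun_tnthP => i.
rewrite (_ : _ \o _ = x i); first exact: measurable_feature_tuple (pop i).
by apply/funext => w; rewrite /= tnth_train_features.
Qed.

Let mZ i : measurable_fun [set: T] (Z i).
Proof.
apply: measurable_fun_pair; first exact: measurable_feature_tuple (pop i).
exact: measurable_RV.
Qed.

Lemma sqint_train_noise i : sqint P (eps i).
Proof. by case: (sqint_noise (pop i) b). Qed.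

Let epsE i w : residual b (Z i w) = eps i w.
Proof. exact: (@residualE _ _ _ P p Sigma (z i) (fun b => y b i) b w). Qed.

Let m1 (B : set (p.-tuple R)) : measurable B ->
  measurable_fun [set: p.-tuple R * R] (fun u => \1_B u.1 : R).
Proof. by move=> mB; apply: measurableT_comp => //; exact: measurable_indic. Qed.

Let mx i B : measurable B -> measurable (x i @^-1` B).
Proof.
move=> mB; rewrite -[X in measurable X]setTI.
exact: (measurable_feature_tuple (pop i)).
Qed.

(** The noise in row [i] is centred given the features of that row and independent of the other
    observations, responses included; the latter is what the off-diagonal covariances use. *)
Let noise_other i B C : measurable B -> (forall k, measurable (C k)) ->
  Ex P (fun w => \1_B (x i w) * eps i w * \1_(other_events Z i C) w) = 0.
Proof.
move=> mB mC; pose a (u : p.-tuple R * R) := \1_B u.1 * residual b u.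
have ma : measurable_fun setT a.
  by apply: measurable_funM; [exact: m1|exact: measurable_residual].
have aE w : a (Z i w) = \1_B (x i w) * eps i w by rewrite /a epsE.
have ia : intble P (fun w => a (Z i w)).
  under eq_fun do rewrite aE.
  exact: intble_indic (mx i mB) (sqint_intble (sqint_train_noise i)).
have := indep_Ex mZ (train_indep train b) ma ia mC.
under eq_Ex do rewrite aE; move=> ->; under eq_Ex do rewrite aE.
by rewrite (noise_cond_moments (pop i) b mB).1 mul0r.
Qed.

Let noise2_other i B C : measurable B -> (forall k, measurable (C k)) ->
  Ex P (fun w => \1_B (x i w) * eps i w ^+ 2 * \1_(other_events Z i C) w) =
  sigma ^+ 2 * Ex P (fun w => \1_B (x i w) * \1_(other_events Z i C) w).
Proof.
move=> mB mC; pose a (u : p.-tuple R * R) := \1_B u.1 * residual b u ^+ 2.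
have ma : measurable_fun setT a.
  apply: measurable_funM; [exact: m1|apply: measurable_funX; exact: measurable_residual].
have aE w : a (Z i w) = \1_B (x i w) * eps i w ^+ 2 by rewrite /a epsE.
have ia : intble P (fun w => a (Z i w)).
  under eq_fun do rewrite aE.
  by apply: (intble_indic (mx i mB)); case: (sqint_train_noise i).
have i1 : intble P (fun w => \1_B (Z i w).1).
  by apply: eq_intble (intble_indic (mx i mB) (intble_cst P 1)) => w; rewrite mulr1.
have := indep_Ex mZ (train_indep train b) (m1 mB) i1 mC => /= ->.
have := indep_Ex mZ (train_indep train b) ma ia mC.
under eq_Ex do rewrite aE; move=> ->; under eq_Ex do rewrite aE.
by rewrite (noise_cond_moments (pop i) b mB).2 mulrA.
Qed.

Let rectE i C w : \1_(tuple_rect C) (X w) =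
  \1_(C i) (x i w) * \1_(other_events Z i (fun k => fst @^-1` C k)) w :> R.
Proof.
rewrite -[_ (x i w)]/(\1_(x i @^-1` C i) w) indicM !indicE.
congr ((nat_of_bool _)%:R); apply/idP/idP; rewrite !inE.
  move=> h; split; first by have := h i I; rewrite /= tnth_train_features.
  by move=> k _; have := h k I; rewrite /= tnth_train_features.
move=> [hi h] k _; rewrite /= tnth_train_features.
by have [->//|ki] := eqVneq k i; exact: h.
Qed.

Let mfst C : (forall k : 'I_n, measurable (C k)) ->
  forall k, measurable (fst @^-1` C k : set (p.-tuple R * R)).
Proof. by move=> mC k; rewrite -[X in measurable X]setTI; exact: measurable_fst. Qed.

Let iX f B : measurable B -> intble P f -> intble P (fun w => \1_B (X w) * f w).
Proof.
move=> mB; apply: (@intble_bounded_mul _ _ _ _ 1).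
  apply: measurableT_comp; [exact: measurable_indic|exact: measurable_train_features].
by move=> w; rewrite indicE; case: (_ \in _); rewrite ?normr1 ?normr0.
Qed.

Lemma Ex_train_noise i B : measurable B ->
  Ex P (fun w => \1_B (X w) * eps i w) = 0.
Proof.
apply: (Ex_tuple_ortho measurable_train_features (sqint_intble (sqint_train_noise i))).
move=> C mC; rewrite -(noise_other i (mC i) (mfst mC)).
by apply: eq_Ex => w; rewrite (rectE i); ring.
Qed.

Lemma Ex_train_noiseM i j B : measurable B ->
  Ex P (fun w => \1_B (X w) * (eps i w * eps j w)) =
  (sigma ^+ 2 *+ (i == j)) * Ex P (fun w => \1_B (X w)).
Proof.
(* Subtracting the claimed conditional mean puts the identity in the vanishing form to which
   Dynkin's argument applies. *)
move=> mB; pose f w := eps i w * eps j w - sigma ^+ 2 *+ (i == j).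
have ie : intble P (fun w => eps i w * eps j w).
  by apply: sqintM; exact: sqint_train_noise.
have hf : intble P f by apply: intbleB => //; exact: intble_cst.
have i1 D : measurable D -> intble P (fun w => \1_D (X w)).
  by move=> mD; apply: eq_intble (iX mD (intble_cst P 1)) => w; rewrite mulr1.
have split_f D : measurable D -> Ex P (fun w => \1_D (X w) * f w) =
    Ex P (fun w => \1_D (X w) * (eps i w * eps j w)) -
    (sigma ^+ 2 *+ (i == j)) * Ex P (fun w => \1_D (X w)).
  move=> mD; rewrite -ExZ; last exact: i1.
  rewrite -ExB; [|exact: iX|apply: intbleZ; exact: i1].
  by apply: eq_Ex => w; rewrite /f mulrBr [X in _ - X]mulrC.
apply/eqP; rewrite -subr_eq0 -split_f//; apply/eqP.
apply: (Ex_tuple_ortho measurable_train_features hf) mB => C mC.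
rewrite split_f; last exact: measurable_tuple_rect.
apply/eqP; rewrite subr_eq0; apply/eqP.
have [<-|ij] := eqVneq i j.
  under eq_Ex do rewrite (rectE i) -expr2.
  under [in RHS]eq_Ex do rewrite (rectE i).
  rewrite mulr1n -(noise2_other i (mC i) (mfst mC)).
  by apply: eq_Ex => w; ring.
rewrite mulr0n mul0r.
pose C' k : set (p.-tuple R * R) := fst @^-1` C k.
pose E : set T := \bigcap_(k in [set k | k != i /\ k != j]) (Z k @^-1` C' k).
have mE : measurable E.
  apply: fin_bigcap_measurable => [|k _]; first exact: finite_finset.
  by rewrite -[X in measurable X]setTI; apply: (mZ k) => //; exact: mfst.
(* [f2] gathers the noise of row [j] and every row except [i]. Its conditional mean given
   observation [i] is zero, so it is orthogonal to the factor of row [i], which contains the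
   unbounded [eps i]. *)
pose f2 w := \1_(C j) (x j w) * eps j w * \1_E w.
have if2 : intble P f2.
  have h := intble_indic mE (intble_indic (mx j (mC j)) (sqint_intble (sqint_train_noise j))).
  by apply: eq_intble h => w; rewrite /f2 mulrC.
pose a (u : p.-tuple R * R) := \1_(C i) u.1 * residual b u.
have ma : measurable_fun setT a.
  by apply: measurable_funM; [exact: m1|exact: measurable_residual].
have aE w : a (Z i w) = \1_(C i) (x i w) * eps i w by rewrite /a epsE.
have prodE w : \1_(tuple_rect C) (X w) * (eps i w * eps j w) = a (Z i w) * f2 w.
  rewrite aE /f2 (rectE i).
  have -> : \1_(other_events Z i (fun k => fst @^-1` C k)) w = \1_(C j) (x j w) * \1_E w :> R.
    rewrite -[_ (x j w)]/(\1_(x j @^-1` C j) w) indicM !indicE.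
    congr ((nat_of_bool _)%:R); apply/idP/idP; rewrite !inE.
      by move=> h; split; [apply: h; rewrite /= eq_sym|move=> k [ki kj]; exact: h].
    move=> [hj h] k /= ki; have [->//|kj] := eqVneq k j; exact: h.
  by ring.
under eq_Ex do rewrite prodE.
apply: (Ex_orthogonal (mZ i) ma if2).
- move=> D mD; pose C2 k := if k == i then D else C' k.
  have mC2 k : measurable (C2 k).
    by rewrite /C2; case: ifP => // _; exact: mfst.
  rewrite -(noise_other j (mC j) mC2); apply: eq_Ex => w.
  rewrite /f2 mulrCA; congr (_ * _).
  rewrite -[\1_D _]/(\1_(Z i @^-1` D) w) indicM !indicE.
  congr ((nat_of_bool _)%:R); apply/idP/idP; rewrite !inE.
    move=> [hD h] k /= kj; rewrite /C2; case: eqVneq => [->//|ki].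
    by apply: h.
  move=> h; split; first by have := h i ij; rewrite /= /C2 eqxx.
  by move=> k [ki kj]; have := h k kj; rewrite /= /C2 (negbTE ki).
- have := iX (measurable_tuple_rect mC) ie.
  by under eq_fun do rewrite prodE.
Qed.

Variables (a : n.-tuple (p.-tuple R) -> R) (M : R).
Hypotheses (ma : measurable_fun [set: n.-tuple (p.-tuple R)] a).
Hypothesis (aM : forall u, `|a u| <= M).

Lemma intble_weight f : intble P f -> intble P (fun w => a (X w) * f w).
Proof.
apply: (intble_bounded_mul (c := M)) => //.
exact: measurableT_comp measurable_train_features.
Qed.

Lemma Ex_weight_noise i : Ex P (fun w => a (X w) * eps i w) = 0.
Proof.
have ie := sqint_intble (sqint_train_noise i).
apply: (Ex_orthogonal measurable_train_features ma ie).
  by move=> B mB; exact: Ex_train_noise.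
exact: intble_weight.
Qed.

Lemma Ex_weight_noiseM i j :
  Ex P (fun w => a (X w) * (eps i w * eps j w)) =
  (sigma ^+ 2 *+ (i == j)) * Ex P (fun w => a (X w)).
Proof.
have ie : intble P (fun w => eps i w * eps j w).
  by apply: sqintM; exact: sqint_train_noise.
have i1 : intble P (fun w => a (X w)).
  by apply: eq_intble (intble_weight (intble_cst P 1)) => w; rewrite mulr1.
set c := sigma ^+ 2 *+ (i == j).
have hf : intble P (fun w => eps i w * eps j w - c).
  by apply: intbleB => //; exact: intble_cst.
have : Ex P (fun w => a (X w) * (eps i w * eps j w - c)) = 0.
  apply: (Ex_orthogonal measurable_train_features ma hf); last exact: intble_weight.
  move=> B mB.
  have iB : intble P (fun w => \1_B (X w)).
    by apply: eq_intble (iX mB (intble_cst P 1)) => w; rewrite mulr1.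
  have -> : (fun w => \1_B (X w) * (eps i w * eps j w - c)) =
     (fun w => \1_B (X w) * (eps i w * eps j w) - c * \1_B (X w)).
    by apply/funext => w; rewrite mulrBr [c * _]mulrC.
  by rewrite ExB ?ExZ ?Ex_train_noiseM ?subrr//; [exact: iX|exact: intbleZ].
have -> : (fun w => a (X w) * (eps i w * eps j w - c)) =
    (fun w => a (X w) * (eps i w * eps j w) - c * a (X w)).
  by apply/funext => w; rewrite mulrBr [c * _]mulrC.
rewrite ExB; [|exact: intble_weight|exact: intbleZ].
by rewrite ExZ// => /eqP; rewrite subr_eq0 => /eqP.
Qed.

End Train.

(** * Ridge error *)

(** Squaring reaches the domain where [powR] is an inverse, and the extra factor restores the sign;
    at 0 both sides vanish by convention. *)
Lemma measurable_invr (R : realType) : measurable_fun [set: R] (fun x : R => x^-1).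
Proof.
have -> : (fun x : R => x^-1) = (fun x => x * (x ^+ 2) `^ (-1)).
  apply/funext => x; rewrite powR_inv1 ?sqr_ge0//.
  by have [->|x0] := eqVneq x 0; [rewrite mul0r invr0|field].
apply: measurable_funM => //.
exact: (measurableT_comp (measurable_powR (-1)) (measurable_funX 2 (@measurable_id _ _ setT))).
Qed.

(** * Entrywise measurability of matrix-valued functions *)

Section MeasurableMatrices.
Variables (R : realType) (d : measure_display) (U : measurableType d).

Definition mxmeas m n (A : U -> 'M[R]_(m, n)) : Prop :=
  forall i j, measurable_fun [set: U] (fun u => A u i j).

Lemma mxmeas_cst m n (A : 'M[R]_(m, n)) : mxmeas (fun=> A).
Proof. by move=> i j; exact: measurable_cst. Qed.

Lemma mxmeasM m n p (A : U -> 'M[R]_(m, n)) (B : U -> 'M[R]_(n, p)) :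
  mxmeas A -> mxmeas B -> mxmeas (fun u => A u *m B u).
Proof.
move=> mA mB i j; under eq_fun do rewrite mxE.
by apply: measurable_sum => k; exact: measurable_funM.
Qed.

Lemma mxmeasD m n (A B : U -> 'M[R]_(m, n)) :
  mxmeas A -> mxmeas B -> mxmeas (fun u => A u + B u).
Proof.
by move=> mA mB i j; under eq_fun do rewrite mxE; exact: measurable_funD.
Qed.

Lemma mxmeasZ m n (c : U -> R) (A : U -> 'M[R]_(m, n)) :
  measurable_fun [set: U] c -> mxmeas A -> mxmeas (fun u => c u *: A u).
Proof.
by move=> mc mA i j; under eq_fun do rewrite mxE; exact: measurable_funM.
Qed.

Lemma mxmeasB m n (A B : U -> 'M[R]_(m, n)) :
  mxmeas A -> mxmeas B -> mxmeas (fun u => A u - B u).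
Proof.
move=> mA mB i j; under eq_fun do rewrite !mxE; exact: measurable_funB.
Qed.

Lemma mxmeasT m n (A : U -> 'M[R]_(m, n)) : mxmeas A -> mxmeas (fun u => (A u)^T).
Proof. by move=> mA i j; under eq_fun do rewrite mxE; exact: mA. Qed.

Lemma measurable_det n (A : U -> 'M[R]_n) : mxmeas A ->
  measurable_fun [set: U] (fun u => \det (A u)).
Proof.
move=> mA; apply: measurable_sum => s; apply: measurable_funM => //.
by apply: measurable_prod => i _; exact: mA.
Qed.

Lemma mxmeas_adj n (A : U -> 'M[R]_n) : mxmeas A -> mxmeas (fun u => \adj (A u)).
Proof.
move=> mA i j; under eq_fun do rewrite mxE.
apply: measurable_funM => //; apply: measurable_det => k l.
by under eq_fun do rewrite !mxE; exact: mA.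
Qed.

Lemma measurable_qform n (u v : U -> 'cV[R]_n) (K : 'M[R]_n) :
  mxmeas u -> mxmeas v -> measurable_fun [set: U] (fun w => qform (u w) K (v w)).
Proof.
move=> mu mv; apply: (mxmeasM _ mv); apply: mxmeasM; last exact: mxmeas_cst.
exact: mxmeasT.
Qed.

Lemma measurable_ntr n (A : U -> 'M[R]_n) : mxmeas A ->
  measurable_fun [set: U] (fun u => ntr (A u)).
Proof.
move=> mA; apply: measurable_funM => //.
by apply: measurable_sum => i; exact: mA.
Qed.

Lemma measurable_mxtrace n (A : U -> 'M[R]_n) : mxmeas A ->
  measurable_fun [set: U] (fun u => \tr (A u)).
Proof. by move=> mA; apply: measurable_sum => i; exact: mA. Qed.

Lemma measurable_norm_le (f : U -> R) (N : R) : measurable_fun [set: U] f ->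
  measurable [set u | `|f u| <= N].
Proof.
move=> mf; have mn : measurable_fun [set: U] (fun u => `|f u|).
  exact: (measurableT_comp (@normr_measurable R setT) mf).
have -> : [set u | `|f u| <= N] = (fun u => `|f u|) @^-1` `]-oo, N].
  by apply/seteqP; split => u /=; rewrite in_itv.
by rewrite -[X in measurable X]setTI; apply: mn => //; exact: measurable_itv.
Qed.

Lemma measurable_mx_bounded m n (A : U -> 'M[R]_(m, n)) (N : R) : mxmeas A ->
  measurable [set u | forall i j, `|A u i j| <= N].
Proof.
move=> mA; have -> : [set u | forall i j, `|A u i j| <= N] =
    \bigcap_(i in [set: 'I_m]) \bigcap_(j in [set: 'I_n]) [set u | `|A u i j| <= N].
  by apply/seteqP; split => [u h i _ j _|u h i j]; [exact: h|exact: (h i I j I)].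
apply: fin_bigcap_measurable => [|i _]; first exact: finite_finset.
apply: fin_bigcap_measurable => [|j _]; first exact: finite_finset.
exact: measurable_norm_le.
Qed.

End MeasurableMatrices.

Section RidgeError.
Variables (R : realType) (n p : nat) (Sigma0 : 'M[R]_p) (X : 'M[R]_(n, p)).
Variable lambda : R.

Definition penalized : 'M[R]_p := gram X + lambda%:M.
(* Equal to [invmx penalized] on the event of interest, and visibly measurable. *)
Definition adjinv : 'M[R]_p := (\det penalized)^-1 *: \adj penalized.
Definition noise_map : 'M[R]_(p, n) := n%:R^-1 *: (adjinv *m X^T).

(** This matrix and the next two are the coefficients of the Sigma0-quadratic form of the ridge
    error, seen as a polynomial in the signal and the noise. *)
Definition bias_mx : 'M[R]_p := lambda ^+ 2 *: (adjinv^T *m Sigma0 *m adjinv).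
Definition cross_mx : 'M[R]_(p, n) :=
  (2 * lambda) *: (adjinv^T *m Sigma0 *m noise_map).
Definition var_mx : 'M[R]_n := noise_map^T *m Sigma0 *m noise_map.

Hypothesis sS0 : Sigma0^T = Sigma0.
Hypothesis dM : \det penalized != 0.

Lemma adjinvE : adjinv = invmx penalized.
Proof. by rewrite /invmx unitmxE unitfE dM. Qed.

Lemma penalized_unit : penalized \in unitmx.
Proof. by rewrite unitmxE unitfE. Qed.

(** Writing gram X b as penalized b - lambda b isolates the shrinkage bias. *)
Lemma ridge_error (b : 'cV[R]_p) (e : 'cV[R]_n) :
  ridge X (X *m b + e) lambda - b = noise_map *m e - lambda *: (adjinv *m b).
Proof.
rewrite /ridge -/penalized mpinv_unit ?penalized_unit// -adjinvE.
have Mb : adjinv *m (penalized *m b) = b.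
  by rewrite adjinvE mulmxA mulVmx ?penalized_unit// mul1mx.
have -> : n%:R^-1 *: (X^T *m (X *m b + e)) =
    penalized *m b - lambda *: b + n%:R^-1 *: (X^T *m e).
  rewrite mulmxDr scalerDr mulmxA; congr (_ + _).
  by rewrite /penalized mulmxDl mul_scalar_mx addrK /gram -scalemxAl.
rewrite mulmxDr mulmxBr Mb /noise_map; move: adjinv => Mi.
rewrite -scalemxAl -!scalemxAr mulmxA.
by rewrite addrAC [b - _]addrC addrK addrC.
Qed.

Lemma qform_ridge_error (b : 'cV[R]_p) (e : 'cV[R]_n) :
  let v := noise_map *m e - lambda *: (adjinv *m b) in
  qform v Sigma0 v = qform b bias_mx b + qform e var_mx e -
    (b^T *m cross_mx *m e) 0 0.
Proof.
move=> v; rewrite /qform {}/v /bias_mx /cross_mx /var_mx.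
move: noise_map adjinv => A Mi.
have tB (a c : 'cV[R]_p) : (a - c)^T = a^T - c^T by rewrite linearB.
have tZ k (a : 'cV[R]_p) : (k *: a)^T = k *: a^T by rewrite linearZ.
rewrite tB tZ !trmx_mul.
have tr1 (a : 'M[R]_1) : a 0 0 = a^T 0 0 by rewrite mxE.
have cr : (e^T *m A^T *m Sigma0 *m (Mi *m b)) 0 0 = (b^T *m (Mi^T *m Sigma0 *m A) *m e) 0 0.
  by rewrite [LHS]tr1 !trmx_mul !trmxK sS0 !mulmxA.
rewrite mulmxBl mulmxBl !mulmxBr.
rewrite -!scalemxAl -!scalemxAr.
have E00 (a c : 'M[R]_1) : (a - c) 0 0 = a 0 0 - c 0 0 by rewrite mxE [in X in _ + X]mxE.
have Z00 k (a : 'M[R]_1) : (k *: a) 0 0 = k * a 0 0 by rewrite mxE.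
rewrite !E00 !Z00 cr.
have -> : (b^T *m Mi^T *m Sigma0 *m (A *m e)) = (b^T *m (Mi^T *m Sigma0 *m A) *m e).
  by rewrite !mulmxA.
have -> : (b^T *m Mi^T *m Sigma0 *m (Mi *m b)) = (b^T *m (Mi^T *m Sigma0 *m Mi) *m b).
  by rewrite !mulmxA.
have -> : (e^T *m A^T *m Sigma0 *m (A *m e)) = (e^T *m (A^T *m Sigma0 *m A) *m e).
  by rewrite !mulmxA.
by rewrite -!scalemxAl !Z00; ring.
Qed.

End RidgeError.

(** Measurable over all designs, and the true estimation error wherever the penalized matrix is
    invertible. *)
Definition ridge_err (R : realType) n p (lambda : R) (X : 'M[R]_(n, p)) (b : 'cV[R]_p)
    (e : 'cV[R]_n) : 'cV[R]_p :=
  noise_map X lambda *m e - lambda *: (adjinv X lambda *m b).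

Section RidgeMeasurability.
Variables (R : realType) (n p : nat) (Sigma0 : 'M[R]_p) (lambda : R).
Variables (d : measure_display) (U : measurableType d) (X : U -> 'M[R]_(n, p)).
Hypothesis mX : mxmeas X.

Lemma mxmeas_penalized : mxmeas (fun u => penalized (X u) lambda).
Proof.
apply: mxmeasD; last exact: mxmeas_cst.
by apply: mxmeasZ => //; apply: mxmeasM => //; exact: mxmeasT.
Qed.

Lemma mxmeas_adjinv : mxmeas (fun u => adjinv (X u) lambda).
Proof.
apply: mxmeasZ; last exact: mxmeas_adj mxmeas_penalized.
exact: (measurableT_comp (@measurable_invr R) (measurable_det mxmeas_penalized)).
Qed.

Lemma mxmeas_noise_map : mxmeas (fun u => noise_map (X u) lambda).
Proof.
apply: mxmeasZ => //; apply: mxmeasM; first exact: mxmeas_adjinv.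
exact: mxmeasT.
Qed.

Lemma mxmeas_bias_mx : mxmeas (fun u => bias_mx Sigma0 (X u) lambda).
Proof.
apply: mxmeasZ => //; apply: mxmeasM; last exact: mxmeas_adjinv.
by apply: mxmeasM; [exact: mxmeasT mxmeas_adjinv|exact: mxmeas_cst].
Qed.

Lemma mxmeas_cross_mx : mxmeas (fun u => cross_mx Sigma0 (X u) lambda).
Proof.
apply: mxmeasZ => //; apply: mxmeasM; last exact: mxmeas_noise_map.
by apply: mxmeasM; [exact: mxmeasT mxmeas_adjinv|exact: mxmeas_cst].
Qed.

Lemma mxmeas_var_mx : mxmeas (fun u => var_mx Sigma0 (X u) lambda).
Proof.
apply: mxmeasM; last exact: mxmeas_noise_map.
by apply: mxmeasM; [exact: mxmeasT mxmeas_noise_map|exact: mxmeas_cst].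
Qed.

Lemma mxmeas_ridge_err (b : U -> 'cV[R]_p) (e : U -> 'cV[R]_n) :
  mxmeas b -> mxmeas e -> mxmeas (fun u => ridge_err lambda (X u) (b u) (e u)).
Proof.
move=> mb me; apply: mxmeasB; first by apply: mxmeasM => //; exact: mxmeas_noise_map.
by apply: mxmeasZ => //; apply: mxmeasM => //; exact: mxmeas_adjinv.
Qed.

End RidgeMeasurability.

(** * Integrals of the averaged risk *)

Definition mx_of_rows (R : realType) n p (u : n.-tuple (p.-tuple R)) : 'M[R]_(n, p) :=
  \matrix_(i, j) tnth (tnth u i) j.

Lemma tuple_of_rowsK (R : realType) n p :
  cancel (@tuple_of_rows R p n) (@mx_of_rows R n p).
Proof. by move=> X; apply/matrixP => i j; rewrite mxE !tnth_mktuple !mxE. Qed.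

Lemma mxmeas_mx_of_rows (R : realType) n p : mxmeas (@mx_of_rows R n p).
Proof.
move=> i j; under eq_fun do rewrite mxE.
exact: (measurableT_comp (measurable_tnth j) (measurable_tnth i)).
Qed.

Section ConditionalRisk.
Variables (R : realType) (n p : nat) (Sigma Sigma0 : 'M[R]_p).
Variables (alpha sigma sigma0 : R).
Variables (dS dT d0 : measure_display).
Variables (TS : measurableType dS) (T : measurableType dT) (T0 : measurableType d0).
Variables (PS : probability TS R) (P : probability T R) (P0 : probability T0 R).
Variables (beta : TS -> 'cV[R]_p).
Variables (z : 'I_n -> 'I_p -> {RV P >-> R}) (y : 'cV[R]_p -> 'I_n -> {RV P >-> R}).
Variables (z0 : 'I_p -> {RV P0 >-> R}) (y0 : 'cV[R]_p -> {RV P0 >-> R}).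
Hypotheses (train : train_sample Sigma sigma z y).
Hypotheses (test : population Sigma0 sigma0 z0 y0).
Hypotheses (signal : isotropic_signal PS alpha beta).
Hypothesis joint : forall i : 'I_n, measurable_fun [set: TS * T]
  (fun tw : TS * T => y (beta tw.1) i tw.2).

Let X w := train_features Sigma z w.
Let U w := tuple_of_rows (X w).
Notation tuples := (n.-tuple (p.-tuple R)).

(* On these events the inverse is a rational function of the design and all
   weights in the conditional risk are bounded, hence integrable. *)
Definition good_designs (N lambda : R) : set tuples :=
  [set u | \det (penalized (mx_of_rows u) lambda) != 0] `&`
  [set u | forall i j, `|bias_mx Sigma0 (mx_of_rows u) lambda i j| <= N] `&`
  [set u | forall i j, `|cross_mx Sigma0 (mx_of_rows u) lambda i j| <= N] `&`
  [set u | forall i j, `|var_mx Sigma0 (mx_of_rows u) lambda i j| <= N].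

(** The closed form that the conditional risk given X takes on the good designs. *)
Definition cond_risk (lambda : R) (u : tuples) : R :=
  alpha ^+ 2 * ntr (bias_mx Sigma0 (mx_of_rows u) lambda) +
  sigma ^+ 2 * \tr (var_mx Sigma0 (mx_of_rows u) lambda) + sigma0 ^+ 2.

Let pS0 : posdefmx Sigma0 := population_posdef test.

Let mmx := @mxmeas_mx_of_rows R n p.

Lemma measurable_good_designs N lambda : measurable (good_designs N lambda).
Proof.
apply: measurableI; last exact: measurable_mx_bounded (mxmeas_var_mx _ _ mmx).
apply: measurableI; last exact: measurable_mx_bounded (mxmeas_cross_mx _ _ mmx).
apply: measurableI; last exact: measurable_mx_bounded (mxmeas_bias_mx _ _ mmx).
have -> : [set u : tuples | \det (penalized (mx_of_rows u) lambda) != 0] =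
    (fun u => \det (penalized (mx_of_rows u) lambda)) @^-1` (~` [set 0]).
  by apply/seteqP; split => u /= /eqP.
rewrite -[X in measurable X]setTI.
by apply: (measurable_det (mxmeas_penalized _ mmx)) => //; exact: measurableC.
Qed.

Lemma measurable_cond_risk lambda : measurable_fun [set: tuples] (cond_risk lambda).
Proof.
apply: measurable_funD => //; apply: measurable_funD; apply: measurable_funM => //.
  exact: measurable_ntr (mxmeas_bias_mx _ _ mmx).
exact: measurable_mxtrace (mxmeas_var_mx _ _ mmx).
Qed.

Let mU : measurable_fun [set: T] U := measurable_train_features train.

Let UK w : mx_of_rows (U w) = X w. Proof. exact: tuple_of_rowsK. Qed.

Let noise b w : 'cV[R]_n := \col_i train_noise Sigma z y b i w.

Lemma train_responsesE b w : train_responses y b w = X w *m b + noise b w.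
Proof.
apply/colP => i; rewrite !mxE /train_noise.
rewrite [X in _ = _ + (_ - X)]mxE [X in _ = _ + (_ - X)](_ : _ = \sum_j X w i j * b j 0).
  by rewrite addrC subrK.
by apply: eq_bigr => j _; rewrite !mxE.
Qed.

Section Design.
Variables (lambda N : R) (B : set tuples).
Hypotheses (mB : measurable B) (BN : B `<=` good_designs N lambda).

Let bias (u : tuples) := bias_mx Sigma0 (mx_of_rows u) lambda.
Let cross (u : tuples) := cross_mx Sigma0 (mx_of_rows u) lambda.
Let var (u : tuples) := var_mx Sigma0 (mx_of_rows u) lambda.

Let F b w := \1_B (U w) *
  (qform (ridge_err lambda (X w) b (noise b w)) Sigma0
     (ridge_err lambda (X w) b (noise b w)) + sigma0 ^+ 2).

Let F_ge0 b w : 0 <= F b w.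
Proof.
rewrite /F mulr_ge0 ?indicE// addr_ge0 ?sqr_ge0// /qform.
set v := ridge_err _ _ _ _; have [->|v0] := eqVneq v 0; last exact/ltW/pS0.2.
by rewrite mulmx0 mxE.
Qed.

Let weight_le (f : tuples -> R) : (forall u, B u -> `|f u| <= N) ->
  forall u, `|\1_B u * f u| <= `|N|.
Proof.
move=> fN u; rewrite indicE; have [uB|uB] := boolP (u \in B).
  by rewrite mul1r (le_trans (fN u _)) ?ler_norm//; exact: set_mem.
by rewrite mul0r normr0.
Qed.

Let bias_le i j u : `|\1_B u * bias u i j| <= `|N|.
Proof. by apply: (weight_le (f := fun u => bias u i j)) => v /BN[[[_ h] _] _]; exact: h. Qed.
Let cross_le i j u : `|\1_B u * cross u i j| <= `|N|.
Proof. by apply: (weight_le (f := fun u => cross u i j)) => v /BN[[_ h] _]; exact: h. Qed.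
Let var_le i j u : `|\1_B u * var u i j| <= `|N|.
Proof. by apply: (weight_le (f := fun u => var u i j)) => v /BN[_ h]; exact: h. Qed.

Let m1 : measurable_fun [set: tuples] (\1_B : tuples -> R) := measurable_indic mB.

Let bias_meas i j : measurable_fun [set: tuples] (fun u => \1_B u * bias u i j).
Proof. by apply: measurable_funM => //; exact: mxmeas_bias_mx mmx i j. Qed.
Let cross_meas i j : measurable_fun [set: tuples] (fun u => \1_B u * cross u i j).
Proof. by apply: measurable_funM => //; exact: mxmeas_cross_mx mmx i j. Qed.
Let var_meas i j : measurable_fun [set: tuples] (fun u => \1_B u * var u i j).
Proof. by apply: measurable_funM => //; exact: mxmeas_var_mx mmx i j. Qed.

Let ibias i j : intble P (fun w => \1_B (U w) * bias (U w) i j).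
Proof.
have := intble_weight train (bias_meas i j) (bias_le i j) (intble_cst P 1).
by under eq_fun do rewrite mulr1.
Qed.

Let ivar i j : intble P (fun w => \1_B (U w) * var (U w) i j).
Proof.
have := intble_weight train (var_meas i j) (var_le i j) (intble_cst P 1).
by under eq_fun do rewrite mulr1.
Qed.

Let i1 : intble P (fun w => \1_B (U w)).
Proof.
have mUB : measurable (U @^-1` B) by rewrite -[X in measurable X]setTI; exact: mU.
by apply: eq_intble (intble_indic mUB (intble_cst P 1)) => w; rewrite mulr1.
Qed.

(** At a fixed signal, integrating over the data leaves a quadratic form in [b] with matrix [Kbar]
    plus the constant [cbar], so only second moments of the signal will matter. *)
Let Kbar : 'M[R]_p := \matrix_(i, j) Ex P (fun w => \1_B (U w) * bias (U w) i j).
Let cbar : R := \sum_i sigma ^+ 2 * Ex P (fun w => \1_B (U w) * var (U w) i i) +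
  sigma0 ^+ 2 * Ex P (fun w => \1_B (U w)).

Let FE b w : F b w =
  \sum_i \sum_j b i 0 * b j 0 * (\1_B (U w) * bias (U w) i j) +
  \sum_i \sum_j \1_B (U w) * var (U w) i j *
     (train_noise Sigma z y b i w * train_noise Sigma z y b j w) -
  \sum_j \sum_i b i 0 * (\1_B (U w) * cross (U w) i j * train_noise Sigma z y b j w) +
  sigma0 ^+ 2 * \1_B (U w).
Proof.
rewrite /F; have [uB|uB] := boolP (U w \in B); last first.
  have -> : \1_B (U w) = 0 :> R by rewrite indicE (negbTE uB).
  by rewrite mul0r mulr0 addr0 !big1 ?subr0 ?addr0// => i _;
    rewrite big1// => j _; rewrite !mul0r ?mulr0.
have [[[dM _] _] _] := BN (set_mem uB); rewrite /= UK in dM.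
have -> : \1_B (U w) = 1 :> R by rewrite indicE uB.
rewrite mul1r mulr1; congr (_ + _).
rewrite (qform_ridge_error _ _ pS0.1) !qformE; congr (_ + _ - _).
- apply: eq_bigr => i _; apply: eq_bigr => j _.
  by rewrite mul1r /bias UK; ring.
- apply: eq_bigr => i _; apply: eq_bigr => j _.
  by rewrite mul1r /var UK !mxE; ring.
- rewrite mxE; apply: eq_bigr => j _; rewrite mxE mulr_suml; apply: eq_bigr => i _.
  by rewrite mul1r /cross UK !mxE; ring.
Qed.

(** Given the design the noise is centred, which kills the cross terms, and white, which keeps only
    the diagonal of the variance matrix. *)
Lemma Ex_design_risk b : intble P (F b) /\ Ex P (F b) = qform b Kbar b + cbar.
Proof.
have sq i := sqint_train_noise train b i.
have h1 i j : intble P (fun w => b i 0 * b j 0 * (\1_B (U w) * bias (U w) i j)).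
  exact: intbleZ.
have h2 i j : intble P (fun w => \1_B (U w) * var (U w) i j *
     (train_noise Sigma z y b i w * train_noise Sigma z y b j w)).
  by apply: (intble_weight train (var_meas i j) (var_le i j)); exact: sqintM.
have h3' i j : intble P (fun w => \1_B (U w) * cross (U w) i j * train_noise Sigma z y b j w).
  by apply: (intble_weight train (cross_meas i j) (cross_le i j)); exact: sqint_intble.
have h3 j i : intble P (fun w => b i 0 * (\1_B (U w) * cross (U w) i j * train_noise Sigma z y b j w)).
  exact: intbleZ.
have h4 := intbleZ (sigma0 ^+ 2) i1.
have k1 := intble_sum (fun i => intble_sum (h1 i)).
have k2 := intble_sum (fun i => intble_sum (h2 i)).
have k3 := intble_sum (fun i => intble_sum (h3 i)).
rewrite (funext (FE b) : F b = _).
split; first by apply: intbleD h4; apply: intbleB k3; exact: intbleD.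
rewrite ExD//; last by apply: intbleB k3; exact: intbleD.
rewrite ExB//; last exact: intbleD.
rewrite ExD// (Ex_sum (fun i => intble_sum (h1 i))) (Ex_sum (fun i => intble_sum (h2 i))).
rewrite (Ex_sum (fun i => intble_sum (h3 i))) [X in _ - X]big1 ?subr0; last first.
  move=> j _; rewrite Ex_sum// big1// => i _; rewrite ExZ//.
  by rewrite (Ex_weight_noise train b (cross_meas i j) (cross_le i j)) mulr0.
rewrite ExZ// -addrA /cbar qformE; congr (_ + (_ + _)).
  apply: eq_bigr => i _; rewrite Ex_sum//; apply: eq_bigr => j _.
  by rewrite ExZ// mxE; ring.
apply: eq_bigr => i _; rewrite Ex_sum// (bigD1 i)//= big1 ?addr0 => [|j ji].
  by rewrite (Ex_weight_noiseM train b (var_meas i i) (var_le i i)) eqxx mulr1n.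
by rewrite (Ex_weight_noiseM train b (var_meas i j) (var_le i j)) eq_sym (negbTE ji) mul0r.
Qed.

Lemma intble_cond_risk : intble P (fun w => \1_B (U w) * cond_risk lambda (U w)).
Proof.
have h1 := intbleZ (alpha ^+ 2 / p%:R) (intble_sum (fun i => ibias i i)).
have h2 := intbleZ (sigma ^+ 2) (intble_sum (fun i => ivar i i)).
apply: eq_intble (intbleD (intbleD h1 h2) (intbleZ (sigma0 ^+ 2) i1)) => w.
rewrite /cond_risk /ntr /mxtrace -!mulr_sumr /bias /var.
by ring.
Qed.

Let Ex_cond_risk : alpha ^+ 2 * ntr Kbar + cbar =
  Ex P (fun w => \1_B (U w) * cond_risk lambda (U w)).
Proof.
have h1 := intbleZ (alpha ^+ 2 / p%:R) (intble_sum (fun i => ibias i i)).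
have h2 := intbleZ (sigma ^+ 2) (intble_sum (fun i => ivar i i)).
have h3 := intbleZ (sigma0 ^+ 2) i1.
have -> : (fun w => \1_B (U w) * cond_risk lambda (U w)) =
  (fun w => alpha ^+ 2 / p%:R * (\sum_i \1_B (U w) * bias (U w) i i) +
    sigma ^+ 2 * (\sum_i \1_B (U w) * var (U w) i i) + sigma0 ^+ 2 * \1_B (U w)).
  apply/funext => w; rewrite /cond_risk /ntr /mxtrace -!mulr_sumr /bias /var.
  by ring.
rewrite ExD//; last exact: intbleD.
rewrite ExD// !ExZ//; [|by apply: intble_sum => i; exact: ivar|by apply: intble_sum => i; exact: ibias].
rewrite Ex_sum// Ex_sum// /cbar -mulr_sumr addrA; congr (_ + _ + _).
rewrite /ntr /mxtrace; under eq_bigr do rewrite mxE.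
by ring.
Qed.

Lemma integral_avg_risk :
  (\int[P]_(w in U @^-1` B) \int[PS]_t ood_risk Sigma0 z0 y0 (beta t)
     (ridge (X w) (train_responses y (beta t) w) lambda) =
   (Ex P (fun w => \1_B (U w) * cond_risk lambda (U w)))%:E)%E.
Proof.
pose G (tw : TS * T) : \bar R := (F (beta tw.1) tw.2)%:E.
have mbeta : mxmeas (fun tw : TS * T => beta tw.1).
  move=> j k; rewrite ord1.
  exact: (measurableT_comp (signal_measurable signal j) measurable_fst).
have mXT : mxmeas X.
  move=> i j; under eq_fun do rewrite mxE.
  exact: (sqint_feature (train_pop train i) j).1.
have mX : mxmeas (fun tw : TS * T => X tw.2).
  by move=> i j; exact: (measurableT_comp (mXT i j) measurable_snd).
have mnoise : mxmeas (fun tw : TS * T => noise (beta tw.1) tw.2).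
  move=> i j; under eq_fun do rewrite mxE.
  apply: measurable_funB; first exact: joint.
  under eq_fun do rewrite linear_predictorE.
  apply: measurable_sum => k; apply: measurable_funM; last exact: mbeta.
  exact: (measurableT_comp (sqint_feature (train_pop train i) k).1 measurable_snd).
have mG : measurable_fun setT G.
  apply/measurable_EFinP; apply: measurable_funM.
    exact: (measurableT_comp (measurableT_comp m1 mU) measurable_snd).
  apply: measurable_funD => //; apply: measurable_qform; exact: mxmeas_ridge_err.
have G0 tw : (0 <= G tw)%E by rewrite lee_fin.
rewrite integral_mkcond.
transitivity (\int[P]_w \int[PS]_t G (t, w))%E.
  apply: eq_integral => w _; rewrite patchE.
  have -> : (w \in U @^-1` B) = (U w \in B) by apply/idP/idP; rewrite !inE.
  have [uB|uB] := boolP (U w \in B); last first.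
    under eq_integral do rewrite /G /F /= indicE (negbTE uB) mul0r.
    by rewrite integral0.
  have [[[dM _] _] _] := BN (set_mem uB); rewrite /= UK in dM.
  apply: eq_integral => t _; rewrite (ood_riskE test) train_responsesE.
  by rewrite (ridge_error dM) /G /F indicE uB mul1r.
(* The integrand is nonnegative and jointly measurable, so the data may be integrated first, at a
   fixed signal. *)
rewrite -(@fubini_tonelli _ _ _ _ _ PS P G mG G0).
transitivity (\int[PS]_t (qform (beta t) Kbar (beta t) + cbar)%:E)%E.
  by apply: eq_integral => t _; have [h <-] := Ex_design_risk (beta t); rewrite -ExE.
have iq := intble_signal_qform signal Kbar.
rewrite ExE; last by apply: intbleD => //; exact: intble_cst.
rewrite ExD//; last exact: intble_cst.
by rewrite Ex_cst (Ex_signal_qform signal) Ex_cond_risk.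
Qed.

End Design.

End ConditionalRisk.

(** * Minimization of the conditional risk *)

Section RiskMinimization.
Variables (R : realType) (n p : nat) (Sigma0 : 'M[R]_p) (X : 'M[R]_(n, p)).
Variables (alpha sigma sigma0 lmin lambda : R).
Hypotheses (hp : (0 < p)%N) (hn : (0 < n)%N) (pS0 : posdefmx Sigma0).
Hypotheses (alpha0 : 0 < alpha) (sigma_gt0 : 0 < sigma) (lmin0 : lmin < 0).
Hypotheses (lminl : lmin <= lambda) (pG : posdefmx (gram X - (- lmin)%:M)).

Let lp : R := (p%:R / n%:R) / SNR alpha sigma.

Let p0 : 0 < p%:R :> R. Proof. by rewrite ltr0n. Qed.
Let n0 : 0 < n%:R :> R. Proof. by rewrite ltr0n. Qed.

Let lp0 : 0 < lp.
Proof. by rewrite !divr_gt0// exprn_gt0. Qed.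

Let gram_spectrum : exists Q, exists g, [/\ Q *m Q^T = 1%:M, gram X = fcalc Q g &
  forall i, - lmin < g i].
Proof.
have sG : (gram X)^T = gram X by rewrite /gram linearZ /= trmx_mul trmxK.
have [Q [g [QQ GE]]] := symmx_fcalc sG; exists Q, g; split => // i.
move: pG; rewrite GE -scaleN1r scale_scalar_mx mulN1r opprK (fcalc_scalar QQ) fcalcD//.
by move=> /(posdefmx_fcalc QQ)/(_ i) gi; rewrite -subr_gt0 opprK.
Qed.

Lemma penalized_det_neq0 l : lmin <= l -> \det (penalized X l) != 0.
Proof.
move=> ll; rewrite -unitfE -unitmxE /penalized.
have [Q [g [QQ -> gl]]] := gram_spectrum.
rewrite (fcalc_scalar QQ) fcalcD//; apply: fcalc_unit => // i.
suff : 0 < g i + l by move/gt_eqF ->.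
by have := gl i; move: ll; lra.
Qed.

Let spectral_cond_risk Q g : Q *m Q^T = 1%:M -> gram X = fcalc Q g ->
  (forall i, - lmin < g i) -> forall l, lmin <= l ->
  alpha ^+ 2 * ntr (bias_mx Sigma0 X l) + sigma ^+ 2 * \tr (var_mx Sigma0 X l) =
  \sum_i (Q *m Sigma0 *m Q^T) i i * (alpha ^+ 2 / p%:R * (l ^+ 2 + lp * g i) / (g i + l) ^+ 2).
Proof.
move=> QQ GE gl l ll; have dM := penalized_det_neq0 ll.
have gl0 i : g i + l != 0.
  suff : 0 < g i + l by move/gt_eqF ->.
  by have := gl i; move: ll; lra.
have MiE : adjinv X l = fcalc Q (fun i => (g i + l)^-1).
  by rewrite (adjinvE dM) /penalized GE (fcalc_scalar QQ) fcalcD// fcalcV.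
have -> : ntr (bias_mx Sigma0 X l) =
    (\sum_i (Q *m Sigma0 *m Q^T) i i * (l ^+ 2 / (g i + l) ^+ 2)) / p%:R.
  rewrite /ntr /bias_mx mxtraceZ -[X in \tr X]mulmxA mxtrace_mulC -[X in \tr X]mulmxA MiE.
  rewrite fcalc_tr fcalcM//.
  rewrite trace_fcalc// mulr_sumr; congr (_ / _); apply: eq_bigr => i _.
  by field; exact: gl0.
have -> : \tr (var_mx Sigma0 X l) =
    \sum_i (Q *m Sigma0 *m Q^T) i i * (n%:R^-1 * (g i / (g i + l) ^+ 2)).
  have NN : noise_map X l *m (noise_map X l)^T =
      n%:R^-1 *: (adjinv X l *m gram X *m (adjinv X l)^T).
    have NT : (noise_map X l)^T = n%:R^-1 *: (X *m (adjinv X l)^T).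
      by rewrite /noise_map linearZ /= trmx_mul trmxK.
    rewrite NT /noise_map /gram; move: (adjinv X l) => Mi.
    by rewrite -!scalemxAl -!scalemxAr -!scalemxAl !mulmxA.
  rewrite /var_mx -[X in \tr X]mulmxA mxtrace_mulC -[X in \tr X]mulmxA NN.
  rewrite MiE fcalc_tr GE !fcalcM// fcalcZ trace_fcalc//.
  apply: eq_bigr => i _; congr (_ * _).
  by field; rewrite gl0 gt_eqF.
rewrite mulrA mulrAC !mulr_sumr -big_split /=; apply: eq_bigr => i _.
(* The factor sigma^2 / n of the variance equals alpha^2 / p * lp, which merges the two sums. *)
rewrite /lp /SNR; field.
by rewrite gl0 !gt_eqF.
Qed.

Lemma cond_risk_min :
  alpha ^+ 2 * ntr (bias_mx Sigma0 X lp) + sigma ^+ 2 * \tr (var_mx Sigma0 X lp) <=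
  alpha ^+ 2 * ntr (bias_mx Sigma0 X lambda) + sigma ^+ 2 * \tr (var_mx Sigma0 X lambda).
Proof.
have [Q [g [QQ GE gl]]] := gram_spectrum.
have lminp : lmin <= lp by exact: ltW (lt_trans lmin0 lp0).
rewrite !(spectral_cond_risk QQ GE gl)//; apply: ler_sum => i _.
rewrite ler_pM2l; last by apply: posdef_conj_diag => //; case: pS0.
(* The sign of [lmin] enters here: g_i > -lmin > 0. *)
have gi : 0 < g i by apply: lt_trans (gl i); rewrite oppr_gt0.
have gp : 0 < g i + lp by rewrite addr_gt0.
have glam : 0 < g i + lambda by have := gl i; move: lminl; lra.
have a0 : 0 < alpha ^+ 2 / p%:R by rewrite divr_gt0// exprn_gt0.
rewrite -subr_ge0.
(* At L = lp the quotient reduces to L / (g + L), and (lambda^2 + L g)(g + L) - L (g + lambda)^2 = g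
   (lambda - L)^2. *)
have -> : alpha ^+ 2 / p%:R * (lambda ^+ 2 + lp * g i) / (g i + lambda) ^+ 2 -
    alpha ^+ 2 / p%:R * (lp ^+ 2 + lp * g i) / (g i + lp) ^+ 2 =
    alpha ^+ 2 / p%:R * (g i * (lambda - lp) ^+ 2 / ((g i + lambda) ^+ 2 * (g i + lp))).
  move: lp (gp) => L gpL; field.
  by rewrite !gt_eqF.
apply: mulr_ge0; first exact: ltW.
apply: divr_ge0; first by rewrite mulr_ge0 ?sqr_ge0 ?ltW.
by rewrite mulr_ge0 ?sqr_ge0 ?ltW.
Qed.

End RiskMinimization.

(** * Almost sure comparison of conditional expectations *)

(** Comparing positive and negative parts separately covers functions with infinite values or
    infinite integrals, as versions of a conditional expectation may be. *)
Lemma le_integral_total (R : realType) (d : measure_display) (T : measurableType d)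
    (P : {measure set T -> \bar R}) (D : set T) (f g : T -> \bar R) :
  measurable D -> measurable_fun D f -> measurable_fun D g ->
  (forall x, D x -> f x <= g x)%E ->
  (\int[P]_(x in D) f x <= \int[P]_(x in D) g x)%E.
Proof.
move=> mD mf mg fg; have fgD : {in D, forall x, (f x <= g x)%E}.
  by move=> x /set_mem; exact: fg.
rewrite integralE [leRHS]integralE; apply: leeB.
  apply: ge0_le_integral => //; [exact: measurable_funepos|exact: measurable_funepos|].
  by move=> x Dx; apply: (funepos_le fgD); exact: mem_set.
apply: ge0_le_integral => //; [exact: measurable_funeneg|exact: measurable_funeneg|].
by move=> x Dx; apply: (funeneg_le fgD); exact: mem_set.
Qed.

Lemma ereal_lt_rat (R : realType) (x y : \bar R) : (x < y)%E ->
  exists q r : rat, [/\ q < r, (x <= (ratr q)%:E)%E & ((ratr r)%:E <= y)%E].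
Proof.
move=> xy; have [a [b [ab xa yb]]] : exists a b : R, [/\ a < b, (x <= a%:E)%E & (b%:E <= y)%E].
  case: x xy => [x| |]; case: y => [y| |]//=.
  - by rewrite lte_fin => xy; exists x, y.
  - by move=> _; exists x, (x + 1); split; rewrite ?ltrDl// leey.
  - by move=> _; exists (y - 1), y; split; rewrite ?gtrDl ?ltrN10// leNye.
  - by move=> _; exists 0, 1; split; rewrite ?leey ?leNye.
have [q] := rat_in_itvoo ab; rewrite in_itv /= => /andP[aq qb].
have [r] := rat_in_itvoo qb; rewrite in_itv /= => /andP[qr rb].
exists q, r; split; first by rewrite -(ltr_rat R).
  by rewrite (le_trans xa)// lee_fin ltW.
by rewrite (le_trans _ yb)// lee_fin ltW.
Qed.

(** On the part of [S k] where h2 <= q < r <= h1, the integral inequality gives r P <= q P for the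
    probability P of that event, so it is null. Countably many such events cover the failures of h1
    <= h2 inside the [S k]. *)
Lemma cond_expectation_le (R : realType) (d d' : measure_display)
    (T : measurableType d) (V : measurableType d') (P : probability T R)
    (U : T -> V) (f1 f2 : T -> \bar R) (h1 h2 : V -> \bar R) (S : nat -> set V) :
  measurable_fun [set: T] U -> (forall k, measurable (S k)) ->
  cond_expectation P U f1 h1 -> cond_expectation P U f2 h2 ->
  (forall k B, measurable B -> B `<=` S k ->
    (\int[P]_(w in U @^-1` B) f1 w <= \int[P]_(w in U @^-1` B) f2 w)%E) ->
  {ae P, forall w, (exists k, S k (U w)) -> (h1 (U w) <= h2 (U w))%E}.
Proof.
move=> mU mS [mh1 hh1] [mh2 hh2] h12.
pose B (kqr : nat * rat * rat) : set V := let: (k, q, r) := kqr in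
  S k `&` ([set u | (h2 u <= (ratr q)%:E)%E] `&` [set u | ((ratr r)%:E <= h1 u)%E]).
have mB kqr : measurable (B kqr).
  case: kqr => [[k q] r]; apply: measurableI => //; apply: measurableI.
    by rewrite -[X in measurable X]setTI; exact: emeasurable_fun_infty_c.
  by rewrite -[X in measurable X]setTI; exact: emeasurable_fun_c_infty.
have mUB D : measurable D -> measurable (U @^-1` D).
  by move=> mD; rewrite -[X in measurable X]setTI; exact: mU.
have null k q r : q < r -> P (U @^-1` B (k, q, r)) = 0%E.
  move=> qr; set D := B _; have mD : measurable D by exact: mB.
  have mD' := mUB _ mD.
  have mhU h : measurable_fun [set: V] h -> measurable_fun (U @^-1` D) (fun w => h (U w) : \bar R).
    by move=> mh; apply: measurable_funTS; exact: measurableT_comp.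
  have : ((ratr r)%:E * P (U @^-1` D) <= (ratr q)%:E * P (U @^-1` D))%E.
    rewrite -!integral_cst//.
    apply: (@le_trans _ _ (\int[P]_(w in U @^-1` D) h1 (U w))%E).
      by apply: le_integral_total => //; [exact: mhU|move=> w [_ []]].
    apply: (@le_trans _ _ (\int[P]_(w in U @^-1` D) h2 (U w))%E).
      by rewrite -hh1// -hh2//; apply: (h12 k) => //; move=> u [].
    by apply: le_integral_total => //; [exact: mhU|move=> w [_ []]].
  have fP : P (U @^-1` D) \is a fin_num by exact: fin_num_measure.
  rewrite -(fineK fP) -!EFinM lee_fin -subr_ge0 -mulrBl => h.
  have P0 : 0 <= fine (P (U @^-1` D)) by exact: fine_ge0.
  have qr' : ratr q - ratr r < 0 :> R by rewrite subr_lt0 ltr_rat.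
  congr (_%:E); apply/eqP; rewrite eq_le P0 andbT.
  by rewrite -(nmulr_rge0 _ qr').
have : {ae P, forall w (m : nat), match unpickle m : option (nat * rat * rat) with
    | Some kqr => kqr.1.2 < kqr.2 -> ~ B kqr (U w) | None => True end}.
  apply/ae_foralln => m; case: unpickle => [[[k q] r] /=|]; last exact: aeW.
  have [qr|qr] := boolP (q < r); last by apply: aeW.
  exists (U @^-1` B (k, q, r)); split; [exact: mUB|exact: null|].
  by move=> w /= hw; apply: contrapT => h; apply: hw => _.
apply: filterS => w hw [k Sk]; rewrite leNgt; apply/negP => /ereal_lt_rat[q [r [qr h2q rh1]]].
by have := hw (pickle (k, q, r)); rewrite pickleK /= => /(_ qr); apply.
Qed.

Lemma mx_entries_bounded (R : realType) m n (A : 'M[R]_(m, n)) :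
  exists N : R, forall i j, `|A i j| <= N.
Proof.
exists (\sum_i \sum_j `|A i j|) => i j.
rewrite (bigD1 i)//= (bigD1 j)//= -addrA lerDl addr_ge0// sumr_ge0// => k _.
by rewrite sumr_ge0.
Qed.

(** Goodness for all bounds beyond [N] lets one integer bound serve two penalties at once. *)
Lemma good_designs_exhaust (R : realType) n p (Sigma0 : 'M[R]_p)
    (u : n.-tuple (p.-tuple R)) lambda :
  \det (penalized (mx_of_rows u) lambda) != 0 ->
  exists N : R, forall M, N <= M -> good_designs Sigma0 M lambda u.
Proof.
move=> dM; have [N1 h1] := mx_entries_bounded (bias_mx Sigma0 (mx_of_rows u) lambda).
have [N2 h2] := mx_entries_bounded (cross_mx Sigma0 (mx_of_rows u) lambda).
have [N3 h3] := mx_entries_bounded (var_mx Sigma0 (mx_of_rows u) lambda).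
exists (Num.max N1 (Num.max N2 N3)) => M; rewrite !ge_max => /and3P[m1 m2 m3].
split; [split; [split => //|]|] => i j.
- exact: le_trans (h1 i j) m1.
- exact: le_trans (h2 i j) m2.
- exact: le_trans (h3 i j) m3.
Qed.

Theorem proposition2 (R : realType) (p n : nat)
    (Sigma Sigma0 : 'M[R]_p) (alpha sigma sigma0 : R)
    (dS dT d0 : measure_display)
    (TS : measurableType dS) (T : measurableType dT) (T0 : measurableType d0)
    (PS : probability TS R) (P : probability T R) (P0 : probability T0 R)
    (beta beta0 : TS -> 'cV[R]_p)
    (z : 'I_n -> 'I_p -> {RV P >-> R})
    (y : 'cV[R]_p -> 'I_n -> {RV P >-> R})
    (z0 : 'I_p -> {RV P0 >-> R})
    (y0 : 'cV[R]_p -> {RV P0 >-> R})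
    (hp : (0 < p)%N) (hn : (0 < n)%N)
    (halpha : 0 < alpha) (hsigma : 0 < sigma)
    (htrain : train_sample Sigma sigma z y)
    (htest : population Sigma0 sigma0 z0 y0)
    (hsignal : isotropic_signal PS alpha beta)
    (hjoint : forall i : 'I_n, measurable_fun [set: TS * T]
       (fun tw : TS * T => y (beta tw.1) i tw.2))
    (hSigma : Sigma0 <> Sigma)
    (hbeta : beta0 = beta) :
  (forall phi : R, 0 < phi ->
     argmin_on [set l : \bar R | ((lambda_min Sigma phi)%:E <= l)%E]
       (extend_to_endpoints (lambda_min Sigma phi) (fun lambda =>
          'E_PS[(fun t => equiv_risk Sigma Sigma0 phi sigma sigma0
                            (beta t) (beta0 t) lambda)]%E))
     = [set (phi / SNR alpha sigma)%:E])
  /\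
  (let X := train_features Sigma z in
   let avg_risk (lambda : R) (w : T) : \bar R :=
     (\int[PS]_t ood_risk Sigma0 z0 y0 (beta0 t)
        (ridge (X w) (train_responses y (beta t) w) lambda))%E in
   let lambda_p := (p%:R / n%:R) / SNR alpha sigma in
   forall lmin lambda : R, lmin < 0 -> lmin <= lambda ->
   forall h hopt : n.-tuple (p.-tuple R) -> \bar R,
     cond_expectation P (fun w => tuple_of_rows (X w)) (avg_risk lambda) h ->
     cond_expectation P (fun w => tuple_of_rows (X w)) (avg_risk lambda_p)
       hopt ->
     {ae P, forall w, posdefmx (gram (X w) - (- lmin)%:M) ->
        (hopt (tuple_of_rows (X w)) <= h (tuple_of_rows (X w)))%E}).
Proof.
rewrite hbeta; have pS0 := population_posdef htest.
split=> [phi phi0|X avg_risk lp lmin lambda lmin0 lminl h hopt hh hho].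
  have pS := population_posdef (train_pop htrain (Ordinal hn)).
  case: p hp => // p' _ in Sigma Sigma0 beta beta0 z y z0 y0 htrain htest hsignal hjoint hSigma hbeta pS0 pS *.
  have hh := @argmin_deterministic_risk _ _ _ _ _ _ _ sigma0 pS pS0 phi0 halpha hsigma; apply: hh => l.
  exact: expected_equiv_risk.
(* The inequality between the closed forms is built into the event: this makes it visibly
   measurable, and every design with positive definite shifted Gram matrix lies in [S k] for large
   [k]. *)
pose S (k : nat) : set (n.-tuple (p.-tuple R)) :=
  good_designs Sigma0 k%:R lambda `&` good_designs Sigma0 k%:R lp `&`
  [set u | cond_risk Sigma0 alpha sigma sigma0 lp u <=
           cond_risk Sigma0 alpha sigma sigma0 lambda u].
have mU := measurable_train_features htrain.
have mS k : measurable (S k).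
  apply: measurableI; first by apply: measurableI; exact: measurable_good_designs.
  have mc l : measurable_fun [set: n.-tuple (p.-tuple R)]
      (cond_risk Sigma0 alpha sigma sigma0 l) by exact: measurable_cond_risk.
  have := measurable_fun_ler (mc lp) (mc lambda).
  move=> /(_ measurableT [set true] I); rewrite setTI.
  by congr measurable; apply/seteqP; split => u /=.
have hS k B : measurable B -> B `<=` S k ->
    (\int[P]_(w in (fun w => tuple_of_rows (X w)) @^-1` B) avg_risk lp w <=
     \int[P]_(w in (fun w => tuple_of_rows (X w)) @^-1` B) avg_risk lambda w)%E.
  move=> mB BS.
  have Bl : B `<=` good_designs Sigma0 k%:R lambda by move=> u /BS[[]].
  have Bp : B `<=` good_designs Sigma0 k%:R lp by move=> u /BS[[]].
  have avgE l : B `<=` good_designs Sigma0 k%:R l ->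
      (\int[P]_(w in (fun w => tuple_of_rows (X w)) @^-1` B) avg_risk l w =
       (Ex P (fun w => \1_B (tuple_of_rows (X w)) *
          cond_risk Sigma0 alpha sigma sigma0 l (tuple_of_rows (X w))))%:E)%E.
    move=> BG; exact: (integral_avg_risk htrain htest hsignal hjoint mB BG).
  have key (u v : \bar R) (a b : R) : u = a%:E -> v = b%:E -> a <= b -> (u <= v)%E.
    by move=> -> ->; rewrite lee_fin.
  apply: (key _ _ _ _ (avgE _ Bp) (avgE _ Bl)).
  apply: le_Ex.
  - exact: (intble_cond_risk alpha sigma0 htrain mB Bp).
  - exact: (intble_cond_risk alpha sigma0 htrain mB Bl).
  - move=> w; rewrite indicE; have [/set_mem/BS[_ rle]|_] := boolP (_ \in B); last by rewrite !mul0r.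
    by rewrite !mul1r.
apply: filterS (cond_expectation_le mU mS hho hh hS) => w hw pG; apply: hw.
have lminp : lmin <= lp.
  by rewrite (le_trans (ltW lmin0))// ltW// !divr_gt0 ?ltr0n// exprn_gt0.
have [N1 h1] : exists N : R, forall M, N <= M -> good_designs Sigma0 M lambda (tuple_of_rows (X w)).
  by apply: good_designs_exhaust; rewrite tuple_of_rowsK; exact: penalized_det_neq0 pG _ lminl.
have [N2 h2] : exists N : R, forall M, N <= M -> good_designs Sigma0 M lp (tuple_of_rows (X w)).
  by apply: good_designs_exhaust; rewrite tuple_of_rowsK; exact: penalized_det_neq0 pG _ lminp.
pose k := (Num.truncn (Num.max N1 N2)).+1.
have kN : Num.max N1 N2 <= k%:R by exact: ltW (truncnS_gt _).
exists k; split; first split.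
- by apply: h1; apply: le_trans kN; rewrite le_max lexx.
- by apply: h2; apply: le_trans kN; rewrite le_max lexx orbT.
- by rewrite /= /cond_risk lerD2r !tuple_of_rowsK; exact: (cond_risk_min hp hn pS0 halpha hsigma lmin0 lminl pG).
Qed.
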